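(* For every $\delta>0$, there exists a randomized reduction from a bi-regular Label Cover instance $\mathcal{L}=(A,B,E,\Sigma,\{\pi_e\}_{e\in E})$ with $|\Sigma|=O_\delta(1)$ to a ground set $\mathcal{U}$ and a concept class $\mathcal{C}$ such that, letting $n=|A|+|B|$ and $r=\sqrt{n}/\log n$, the following hold for every sufficiently large $n$: (Size) the reduction runs in time $|\Sigma|^{O(|E|\mathrm{poly}(1/\delta)/r)}$ and $|\mathcal{C}|,|\mathcal{U}|\le |\Sigma|^{O(|E|\mathrm{poly}(1/\delta)/r)}$; (Completeness) if $\mathcal{L}$ is satisfiable then $\mathrm{VC}(\mathcal{C},\mathcal{U})\ge 2r$; (Soundness) if $\mathrm{val}(\mathcal{L})\le \delta^2/100$ then $\mathrm{VC}(\mathcal{C},\mathcal{U})\le(1+\delta)r$ with high probability. Moreover, these properties hold with high probability even when $\delta$ and $|\Sigma|$ are not constants, as long as $\delta\ge \log(1000 n\log|\Sigma|)/r$.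
   Context: A Label Cover instance $\mathcal{L}=(A,B,E,\Sigma,\{\pi_e\}_{e\in E})$ consists of a bipartite graph $(A,B,E)$, a finite alphabet $\Sigma$, and for every edge $(a,b)\in E$ a map $\pi_{(a,b)}:\Sigma\to\Sigma$. An assignment $\phi:A\cup B\to\Sigma$ satisfies edge $(a,b)$ if $\pi_{(a,b)}(\phi(a))=\phi(b)$; $\mathrm{val}(\mathcal{L})$ is the maximum over assignments of the fraction of satisfied edges, and $\mathcal{L}$ is satisfiable if $\mathrm{val}(\mathcal{L})=1$. Bi-regular means all vertices of $A$ have the same degree and all vertices of $B$ have the same degree. For a universe $\mathcal{U}$ and a class $\mathcal{C}$ of sets, $S\subseteq\mathcal{U}$ is shattered if for every $T\subseteq S$ there is $C\in\mathcal{C}$ with $T=S\cap C$, and $\mathrm{VC}(\mathcal{C},\mathcal{U})$ is the largest size of a shattered set. Logarithms are base 2. *)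

(* Defs.v *)
(* MathComp + MathComp-Analysis. *)
From HB Require Import structures.
From mathcomp Require Import all_boot all_order all_algebra.
From mathcomp Require Import reals exp.

Set Implicit Arguments.
Unset Strict Implicit.
Unset Printing Implicit Defensive.

Import Order.TTheory GRing.Theory Num.Theory.
Local Open Scope ring_scope.

Definition log2 {R : realType} (x : R) : R := ln x / ln 2.

(** * Label Cover *)

(* Only the values of [proj] at edges are ever used. *)
Record label_cover (A B Sigma : finType) := LabelCover {
  edges : {set A * B};
  proj : A * B -> Sigma -> Sigma }.

Section LabelCover.
Variables (A B Sigma : finType).
Implicit Type L : label_cover A B Sigma.

Definition degA L (a : A) : nat := #|[set b : B | (a, b) \in edges L]|.
Definition degB L (b : B) : nat := #|[set a : A | (a, b) \in edges L]|.

Definition biregular L : Prop :=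
  (exists dA, forall a, degA L a = dA) /\ (exists dB, forall b, degB L b = dB).

(* The disjoint union of the two vertex classes is the sum type [A + B]. *)
Definition satisfied L (phi : {ffun A + B -> Sigma}) : {set A * B} :=
  [set e in edges L | proj L e (phi (inl e.1)) == phi (inr e.2)].

Definition lc_val (R : realType) L : R :=
  (\max_(phi : {ffun A + B -> Sigma}) #|satisfied L phi|)%N%:R
    / #|edges L|%:R.

Definition satisfiable (R : realType) L : bool := lc_val R L == 1.

End LabelCover.

(** * VC dimension *)

Section VC.
Variable U : finType.

Definition shattered (C : {set {set U}}) (S : {set U}) : bool :=
  [forall T : {set U}, (T \subset S) ==> [exists D in C, T == S :&: D]].

Definition VC (C : {set {set U}}) : nat :=
  \max_(S : {set U} | shattered C S) #|S|.

End VC.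

(** * Randomized algorithms

   A structured random access machine with fair coin flips. Registers and
   memory cells hold natural numbers; every step costs 1. Addition and
   truncated subtraction are the only arithmetic, so a number produced within
   [t] steps is longer than those in the program and the input by at most [t]
   bits, and the model is polynomially equivalent to randomized Turing
   machines. *)

Inductive instr : Type :=
| IConst (x n : nat)                 (* x := n *)
| IAdd (x y z : nat)                 (* x := y + z *)
| ISub (x y z : nat)                 (* x := y - z, truncated at 0 *)
| IRead (x y : nat)                  (* x := memory[y] *)
| IWrite (x y : nat)                 (* memory[x] := y *)
| IFlip (x : nat)                    (* x := a fresh random bit *)
| IIf (x : nat) (p q : seq instr)    (* if x <> 0 then p else q *)
| IWhile (x : nat) (p : seq instr).  (* while x <> 0 do p *)

Record state := State {
  reg : nat -> nat;
  memory : nat -> nat;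
  coins : seq bool }.

(* The instructions still to be executed (none: the machine has halted) and
   the current state. *)
Definition config := (seq instr * state)%type.

Definition set_reg (s : state) (x v : nat) : state :=
  State [eta reg s with x |-> v] (memory s) (coins s).

(* An exhausted coin sequence yields 0; this cannot happen during the first
   [T] steps of a run started with [T] coins. *)
Definition step (c : config) : config :=
  let s := c.2 in
  match c.1 with
  | [::] => c
  | IConst x n :: k => (k, set_reg s x n)
  | IAdd x y z :: k => (k, set_reg s x (reg s y + reg s z)%N)
  | ISub x y z :: k => (k, set_reg s x (reg s y - reg s z)%N)
  | IRead x y :: k => (k, set_reg s x (memory s (reg s y)))
  | IWrite x y :: k =>
      (k, State (reg s) [eta memory s with reg s x |-> reg s y] (coins s))
  | IFlip x :: k =>
      (k, State [eta reg s with x |-> nat_of_bool (head false (coins s))]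
            (memory s) (behead (coins s)))
  | IIf x p q :: k => ((if reg s x != 0%N then p else q) ++ k, s)
  | IWhile x p :: k =>
      (if reg s x != 0%N then p ++ IWhile x p :: k else k, s)
  end.

Definition halted (c : config) : bool := nilp c.1.

Definition run (P : seq instr) (input : seq nat) (T : nat) (w : T.-tuple bool)
  : config :=
  iter T step (P, State (fun=> 0%N) (fun i => nth 0%N input i) w).

(* Probability of an event over [T] independent fair coin flips. *)
Definition Pr {R : realType} (T : nat) (E : T.-tuple bool -> bool) : R :=
  #|[set w | E w]|%:R / 2 ^+ T.

(** * Input and output encodings

   The input is an integer [m], the sizes |A|, |B|, |Sigma|, |E|, and then for
   each edge its two end points followed by the table of its projection. *)
Definition encode (a b s : nat) (m : nat) (L : label_cover 'I_a 'I_b 'I_s)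
  : seq nat :=
  [:: m; a; b; s; #|edges L|]
  ++ flatten [seq nat_of_ord e.1 :: nat_of_ord e.2
                    :: [seq nat_of_ord (proj L e x) | x <- enum 'I_s]
             | e <- enum (edges L)].

(* A final memory describes the ground set {0, ..., memory[0] - 1} and memory[1]
   concepts, the j-th one given by its characteristic vector, stored from cell
   2 + j * memory[0] on. *)
Definition ground (c : config) : finType := 'I_(memory c.2 0).

Definition concept (c : config) (j : nat) : {set ground c} :=
  [set x : 'I_(memory c.2 0) | memory c.2 (2 + j * memory c.2 0 + x)%N != 0%N].

Definition concept_class (c : config) : {set {set ground c}} :=
  [set concept c j | j : 'I_(memory c.2 1)].

(** * The reduction *)

Section Reduction.
Variable R : realType.

Definition r_of (n : nat) : R := Num.sqrt n%:R / log2 n%:R.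

(* A machine cannot be given a real number, so it is given the integer
   ceil (1/delta) in place of delta. *)
Definition delta_code (delta : R) : nat := `|Num.ceil delta^-1|%N.

Variables (a b s : nat) (L : label_cover 'I_a 'I_b 'I_s).

(* |Sigma| ^ (|E| p(1/delta) / r); [p] also absorbs the constant of the big-O
   in the exponent. *)
Definition size_bound (p : {poly R}) (delta : R) : R :=
  s%:R `^ (#|edges L|%:R * p.[delta^-1] / r_of (a + b)).

Definition time_bound (p : {poly R}) (delta : R) : nat :=
  Num.truncn (size_bound p delta).

Definition reduction (P : seq instr) (p : {poly R}) (delta : R)
    (w : (time_bound p delta).-tuple bool) : config :=
  run P (encode (delta_code delta) L) w.

(* Applied to [reduction P p delta w], [halted] says that the machine stops
   within the time bound. *)
Definition size_property (p : {poly R}) (delta : R) (c : config) : bool :=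
  [&& halted c,
      #|concept_class c|%:R <= size_bound p delta
    & #|ground c|%:R <= size_bound p delta].

Definition completeness_property (c : config) : bool :=
  satisfiable R L ==> (2 * r_of (a + b) <= (VC (concept_class c))%:R).

Definition soundness_property (delta : R) (c : config) : bool :=
  (lc_val R L <= delta ^+ 2 / 100)
    ==> ((VC (concept_class c))%:R <= (1 + delta) * r_of (a + b)).

End Reduction.

Arguments reduction {R a b s} L P p delta w.

(* Main.v *)
(* Only the labels of [A] are put into the ground set. Cut [A] into
   rho = r + O(1) blocks; the ground set consists of rho elements selecting a
   list of tests and of all pairs (block, assignment to the block). A test is a
   random vertex of [B]; each of the 2^rho lists contains O(rho / delta)
   independent tests. A concept is given by a list [H], by labels for the
   vertices tested in [H], and by a set [I] of blocks: it contains the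
   assignments to the blocks in [I] that project to these labels along all
   edges into tested vertices. A satisfying assignment thus yields a shattered
   set with 2 rho elements.

   Conversely let [W] be shattered and choose one element of [W] in each of the
   m blocks that it meets. The 2^(|W| - m) subsets of [W] containing the chosen
   elements come from concepts with different lists, and for each of these lists
   the chosen assignments agree at all tested vertices. If |W| > (1 + delta) r,
   then m >= delta r - O(1), and as the value is at most delta^2 / 100, a constant
   times delta |B| of the vertices of [B] see two different labels (bi-regularity
   is used here). So a random list is passed with probability at most 2^(-3 rho),
   and a union bound over the choices of assignments and over the sets of
   2^(delta r - O(1)) lists shows that this is unlikely. *)

Require Import Defs.
From HB Require Import structures.
From mathcomp Require Import all_boot all_order all_algebra.
From mathcomp Require Import reals exp.
From mathcomp Require Import zify lra ring.
From Stdlib Require Import FunctionalExtensionality.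

Set Implicit Arguments.
Unset Strict Implicit.
Unset Printing Implicit Defensive.

Import Order.TTheory GRing.Theory Num.Theory.
Local Open Scope ring_scope.

(** The number of tests comes from this count. Let D = [delta_code delta], so D >= 1/delta. A test
    is a string of [lbits] coins, and as 2^lbits <= 2 b, having at least b/(4 D) inconsistent
    vertices makes it fail with probability at least 1/(8 D). A group of 8 D tests halves the chance
    of passing, and 3 rho groups give 2^(-3 rho): hence 24 D rho tests. Of this factor, 2^rho per
    list pays for choosing the list; the remaining 2^(-2 rho) per list, over 2^h lists with h >
    delta r - 2, must beat at most s^(3 n) choices of assignments. The condition on delta yields 2^h
    >= 250 n log2 s, which leaves a failure probability of at most 2^(-n). The other obstacle is the
    running time: the reduction is a concrete program using only addition and subtraction, with O(E
    poly(1/delta) / r) in the exponent. So all loop lengths are bounded by one number B =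
    s^[log_bound], every construct costs a bounded number of factors B, and the nesting depth is
    fixed. The total B^400 only changes the constant in [p]. *)

Section Machine.
Local Open Scope nat_scope.

(** * Composition of program runs *)

Definition exec (P : seq instr) (s : state) (t : nat) (s' : state) : Prop :=
  forall k, iter t step (P ++ k, s) = (k, s').

Lemma exec_nil s : exec [::] s 0 s.
Proof. by []. Qed.

(** The continuation quantified in [exec] stands for whatever code follows, so a run of [P] stops
    exactly where a run of [Q] can start, and the times add up. *)
Lemma exec_cat P Q s1 s2 s3 t u :
  exec P s1 t s2 -> exec Q s2 u s3 -> exec (P ++ Q) s1 (t + u) s3.
Proof. by move=> hP hQ k; rewrite addnC iterD -catA hP hQ. Qed.

Lemma exec_cons i P s1 s2 s3 t :
  (forall k, step (i :: k, s1) = (k, s2)) -> exec P s2 t s3 ->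
  exec (i :: P) s1 t.+1 s3.
Proof. by move=> hi hP k; rewrite iterSr cat_cons hi hP. Qed.

Lemma exec_while0 x p s : reg s x = 0 -> exec [:: IWhile x p] s 1 s.
Proof. by move=> hx k /=; rewrite /step /= hx. Qed.

Lemma exec_while x p s1 s2 s3 t u :
  reg s1 x != 0 -> exec p s1 t s2 -> exec [:: IWhile x p] s2 u s3 ->
  exec [:: IWhile x p] s1 (t + u).+1 s3.
Proof.
move=> hx hp hw k; rewrite iterSr addnC iterD.
rewrite [step _](_ : _ = (p ++ IWhile x p :: k, s1)); first by rewrite hp; exact: hw.
by rewrite /step /=; case: eqP hx.
Qed.

(** * Code generators *)

(* [c d] leaves its value in register [d] and may use every register from [d]
   on as scratch space; the registers below [d] hold the variables in scope. *)
Definition code := nat -> seq instr.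

(* The number of variables in scope and their values. *)
Definition ctx := (nat * (nat -> nat))%type.

Definition extends (G G' : ctx) : Prop :=
  G.1 <= G'.1 /\ forall x, x < G.1 -> G'.2 x = G.2 x.

Lemma extends_refl G : extends G G.
Proof. by []. Qed.

Lemma extends_trans G1 G2 G3 : extends G1 G2 -> extends G2 G3 -> extends G1 G3.
Proof.
move=> [h1 e1] [h2 e2]; split=> [|x hx]; first exact: leq_trans h2.
by rewrite e2 ?e1 //; exact: leq_trans h1.
Qed.

(* Time bounds are powers of a common bound [B] on the numbers of iterations
   of all loops. *)
Variable B : nat.
Hypothesis B20 : 20 <= B.

Let B1 : 0 < B. Proof. exact: leq_trans B20. Qed.

(** The contract holds at every depth [d] above an intact scope, so the same code can be placed on
    top of any number of pending intermediate results, as on a stack. *)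
Definition evals (m : nat -> nat) (c : code) (G : ctx) (v e : nat) : Prop :=
  forall d s, extends G (d, reg s) -> memory s = m ->
  exists t s', [/\ t <= B ^ e, exec (c d) s t s' &
    [/\ reg s' d = v, forall x, x < d -> reg s' x = reg s x,
        memory s' = m & coins s' = coins s]].

Lemma evals_extends m c G G' v e :
  extends G G' -> evals m c G v e -> evals m c G' v e.
Proof. by move=> hG hc d s hd; apply: hc; exact: extends_trans hd. Qed.

(** There is no move instruction; a register is copied by adding it to zero. *)
Definition cvar x : code := fun d => [:: IConst d 0; IAdd d d x].
Definition ccst n : code := fun d => [:: IConst d n].
Definition cadd (c1 c2 : code) : code :=
  fun d => c1 d ++ c2 d.+1 ++ [:: IAdd d d d.+1].
Definition csub (c1 c2 : code) : code :=
  fun d => c1 d ++ c2 d.+1 ++ [:: ISub d d d.+1].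
Definition cread (c : code) : code := fun d => c d ++ [:: IRead d d].
(** Register [d] holds the accumulator, [d.+1] the index, [d.+2] the number of rounds left, [d.+3]
    the new accumulator and [d.+4] constants. *)
Definition citer (n i : code) (body : code -> code -> code) : code :=
  fun d => i d ++ IConst d.+1 0 :: n d.+2 ++
    [:: IWhile d.+2 (body (cvar d.+1) (cvar d) d.+3 ++
          [:: IConst d.+4 0; IAdd d d.+3 d.+4;
              IConst d.+4 1; IAdd d.+1 d.+1 d.+4; ISub d.+2 d.+2 d.+4])].

Lemma evals_var m G x : x < G.1 -> evals m (cvar x) G (G.2 x) 1.
Proof.
move=> hx d s [/= hd hr] hm; exists 2, (set_reg (set_reg s d 0) d (reg s x)).
have nxd : (x == d) = false by apply/negbTE; rewrite neq_ltn (leq_trans hx).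
split; first by rewrite expn1 (leq_trans _ B20).
  do 2![apply: exec_cons; first by move=> ?; rewrite /step /=; exact: erefl].
  by move=> k /=; rewrite /set_reg /= eqxx nxd.
split=> //= [|y hy]; first by rewrite eqxx hr.
by case: eqP hy => // ->; rewrite ltnn.
Qed.

Lemma evals_cst m G n : evals m (ccst n) G n 0.
Proof.
move=> d s _ hm; exists 1, (set_reg s d n); split=> //.
split=> //= [|y hy]; first by rewrite eqxx.
by case: eqP hy => // ->; rewrite ltnn.
Qed.

Lemma expB_max e1 e2 : maxn (B ^ e1) (B ^ e2) <= B ^ maxn e1 e2.
Proof. by rewrite geq_max !leq_pexp2l // ?leq_maxl ?leq_maxr. Qed.

(** One more factor [B] absorbs both summands and a few extra instructions, since 2 + 18 <= [B]. *)
Lemma expB_add2 e1 e2 n : n <= 18 -> B ^ e1 + B ^ e2 + n <= B ^ (maxn e1 e2).+1.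
Proof.
move=> hn; have := expB_max e1 e2; rewrite geq_max => /andP[h1 h2].
have h0 : 0 < B ^ maxn e1 e2 by rewrite expn_gt0 B1.
rewrite expnS; apply: (@leq_trans (20 * B ^ maxn e1 e2)); first lia.
by rewrite leq_mul2r B20 orbT.
Qed.

Lemma evals_two m c1 c2 G v1 v2 e1 e2 d s :
  evals m c1 G v1 e1 -> evals m c2 G v2 e2 ->
  extends G (d, reg s) -> memory s = m ->
  exists t s', [/\ t <= B ^ e1 + B ^ e2, exec (c1 d ++ c2 d.+1) s t s' &
    [/\ reg s' d = v1, reg s' d.+1 = v2, forall x, x < d -> reg s' x = reg s x,
        memory s' = m & coins s' = coins s]].
Proof.
move=> h1 h2 hG hm.
have [t1 [s1 [ht1 x1 [r1 f1 m1 k1]]]] := h1 d s hG hm.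
have hG1 : extends G (d.+1, reg s1).
  apply: extends_trans hG _; split=> //= x hx; exact: f1.
have [t2 [s2 [ht2 x2 [r2 f2 m2 k2]]]] := h2 d.+1 s1 hG1 m1.
exists (t1 + t2), s2; split; [by rewrite leq_add|exact: exec_cat x2|split=> //].
- by rewrite f2.
- by move=> x hx; rewrite f2 ?f1 // ltnW.
- by rewrite k2.
Qed.

Lemma evals_add m c1 c2 G v1 v2 e1 e2 :
  evals m c1 G v1 e1 -> evals m c2 G v2 e2 ->
  evals m (cadd c1 c2) G (v1 + v2) (maxn e1 e2).+1.
Proof.
move=> h1 h2 d s hG hm.
have [t [s1 [ht x1 [ra rb f1 m1 k1]]]] := evals_two h1 h2 hG hm.
exists (t + 1), (set_reg s1 d (v1 + v2)); split.
- by apply: (leq_trans _ (expB_add2 e1 e2 (n := 1) _)) => //; rewrite leq_add2r.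
- rewrite /cadd catA; apply: exec_cat x1 _.
  by apply: exec_cons (exec_nil _) => k; rewrite /step /= ra rb.
split=> //= [|x hx]; first by rewrite eqxx.
by case: eqP hx => [->|_ hx]; rewrite ?ltnn // f1.
Qed.

Lemma evals_sub m c1 c2 G v1 v2 e1 e2 :
  evals m c1 G v1 e1 -> evals m c2 G v2 e2 ->
  evals m (csub c1 c2) G (v1 - v2) (maxn e1 e2).+1.
Proof.
move=> h1 h2 d s hG hm.
have [t [s1 [ht x1 [ra rb f1 m1 k1]]]] := evals_two h1 h2 hG hm.
exists (t + 1), (set_reg s1 d (v1 - v2)); split.
- by apply: (leq_trans _ (expB_add2 e1 e2 (n := 1) _)) => //; rewrite leq_add2r.
- rewrite /csub catA; apply: exec_cat x1 _.
  by apply: exec_cons (exec_nil _) => k; rewrite /step /= ra rb.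
split=> //= [|x hx]; first by rewrite eqxx.
by case: eqP hx => [->|_ hx]; rewrite ?ltnn // f1.
Qed.

Lemma evals_read m c G v e : evals m c G v e -> evals m (cread c) G (m v) e.+1.
Proof.
move=> h d s hG hm.
have [t [s1 [ht x1 [ra f1 m1 k1]]]] := h d s hG hm.
exists (t + 1), (set_reg s1 d (m v)); split.
- have := @expB_add2 e e 0 isT; rewrite maxnn addn0.
  have := expn_gt0 B e; rewrite B1 /=; lia.
- apply: exec_cat x1 _.
  by apply: exec_cons (exec_nil _) => k; rewrite /step /= ra m1.
split=> //= [|x hx]; first by rewrite eqxx.
by case: eqP hx => [->|_ hx]; rewrite ?ltnn // f1.
Qed.

Lemma evals_iter m n i (body : code -> code -> code) G (N : nat) (F : nat -> nat)
    en ei eb :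
  N <= B ->
  evals m n G N en -> evals m i G (F 0) ei ->
  (forall j G' cj ca, j < N -> extends G G' ->
     evals m cj G' j 1 -> evals m ca G' (F j) 1 ->
     evals m (body cj ca) G' (F j.+1) eb) ->
  evals m (citer n i body) G (F N) (maxn (maxn en ei) eb).+2.
Proof.
move=> NB hn hi hb d s hG hm.
have [t1 [s1 [ht1 x1 [r1 f1 m1 k1]]]] := hi d s hG hm.
have hG1 : extends G (d.+2, reg (set_reg s1 d.+1 0)).
  apply: extends_trans hG _; split=> /= [|x hx]; first by lia.
  by case: eqP => [|_]; [lia|exact: f1].
have [t2 [s2 [ht2 x2 [r2 f2 m2 k2]]]] := hn d.+2 (set_reg s1 d.+1 0) hG1 m1.
(* Here [j] counts the rounds still to come, so the accumulator holds [F (N - j)]. A round costs the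
   body, five instructions and the loop test. *)
have main : forall j s3, j <= N -> reg s3 d = F (N - j) ->
    reg s3 d.+1 = N - j -> reg s3 d.+2 = j -> memory s3 = m ->
    (forall x, x < d -> reg s3 x = reg s x) -> coins s3 = coins s ->
    exists t s', [/\ t <= j * (B ^ eb + 6) + 1,
      exec [:: IWhile d.+2 (body (cvar d.+1) (cvar d) d.+3 ++
          [:: IConst d.+4 0; IAdd d d.+3 d.+4;
              IConst d.+4 1; IAdd d.+1 d.+1 d.+4; ISub d.+2 d.+2 d.+4])] s3 t s' &
     [/\ reg s' d = F N, forall x, x < d -> reg s' x = reg s x,
        memory s' = m & coins s' = coins s]].
  elim=> [|j IH] s3 hj ra rb rc hm3 hf hc.
    exists 1, s3; split=> //; first exact: exec_while0.
    by split=> //; rewrite ra subn0.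
  have hG3 : extends G (d.+3, reg s3).
    apply: extends_trans hG _; split=> /= [|x hx]; first by lia.
    exact: hf.
  have hlt : N - j.+1 < N by lia.
  have hv1 : evals m (cvar d.+1) (d.+3, reg s3) (N - j.+1) 1.
    by rewrite -rb; exact: (evals_var _ (G := (d.+3, reg s3))).
  have hv0 : evals m (cvar d) (d.+3, reg s3) (F (N - j.+1)) 1.
    by rewrite -ra; apply: (evals_var _ (G := (d.+3, reg s3))) => /=; lia.
  have [t4 [s4 [ht4 x4 [r4 f4 m4 k4]]]] :=
    hb _ _ _ _ hlt hG3 hv1 hv0 d.+3 s3 (extends_refl _) hm3.
  have e1 : (N - j.+1).+1 = N - j by lia.
  pose s5 := set_reg (set_reg (set_reg (set_reg (set_reg s4 d.+4 0)
     d (F (N - j))) d.+4 1) d.+1 (N - j)) d.+2 j.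
  have x5 : exec [:: IConst d.+4 0; IAdd d d.+3 d.+4;
              IConst d.+4 1; IAdd d.+1 d.+1 d.+4; ISub d.+2 d.+2 d.+4] s4 5 s5.
    do 5![apply: exec_cons; first by move=> ?; rewrite /step /=; exact: erefl].
    move=> k /=; congr (_, _); rewrite /s5 /set_reg /=.
    rewrite !eqxx !eqSS.
    have n1 x : ((x.+1 == x) = false) * ((x == x.+1) = false) by split; lia.
    have n2 x : ((x.+2 == x) = false) * ((x == x.+2) = false) by split; lia.
    have n3 x : ((x.+3 == x) = false) * ((x == x.+3) = false) by split; lia.
    have n4 x : ((x.+4 == x) = false) * ((x == x.+4) = false) by split; lia.
    rewrite ?(n1, n2, n3, n4) addn0 r4 e1 (f4 d.+1) // (f4 d.+2) //.
    by rewrite rb rc addn1 e1 subn1.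
  have [] := IH s5; rewrite /s5 /=.
  - lia.
  - by rewrite !eqxx; do 3![case: eqP; first lia; move=> _].
  - by rewrite !eqxx; case: eqP; first lia.
  - by rewrite !eqxx.
  - by rewrite m4.
  - move=> x hx; do 4![case: eqP; first lia; move=> _].
    by rewrite f4 ?hf //; lia.
  - by rewrite k4.
  move=> t6 [s6 [ht6 x6 post]]; exists (t4 + 5 + t6).+1, s6; split=> //.
  - by rewrite mulSn; lia.
  - apply: exec_while x6; first by rewrite rc.
    exact: exec_cat x5.
have [] := main N s2; rewrite ?subnn //.
- by rewrite f2 /=; last lia; case: eqP => [|_]; [lia|exact: r1].
- by rewrite f2 /= ?eqxx; last lia.
- by move=> x hx; rewrite f2 /= ?f1; [case: eqP; [lia|]|lia|lia].
- by rewrite k2 /= k1.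
move=> t3 [s3 [ht3 x3 post]]; exists (t1 + (t2 + t3).+1), s3; split=> //.
  set e := maxn (maxn en ei) eb.
  have hen : B ^ en <= B ^ e by rewrite leq_pexp2l // /e; lia.
  have hei : B ^ ei <= B ^ e by rewrite leq_pexp2l // /e; lia.
  have heb : B ^ eb <= B ^ e by rewrite leq_pexp2l // /e; lia.
  have h0 : 0 < B ^ e by rewrite expn_gt0 B1.
  have h1 : N * (B ^ eb + 6) <= B * (B ^ e + 6) by rewrite leq_mul ?leq_add2r.
  have h2 : B * 20 * B ^ e <= B * B * B ^ e by rewrite leq_mul2r leq_mul2l B20 !orbT.
  have h3 : B <= B * B ^ e by rewrite leq_pmulr.
  have h4 : B ^ e <= B * B ^ e by rewrite leq_pmull.
  rewrite !expnS mulnA; lia.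
rewrite /citer; apply: exec_cat x1 _.
apply: exec_cons; first by move=> ?; rewrite /step /=; exact: erefl.
exact: exec_cat x2 x3.
Qed.

(** * Commands *)

(* Commands may change memory and consume coins; registers below the scope are
   preserved, and the final memory and coins are given explicitly. *)
Definition does (c : code) (G : ctx) (m : nat -> nat) (w : seq bool)
    (m' : nat -> nat) (w' : seq bool) (e : nat) : Prop :=
  forall d s, extends G (d, reg s) -> memory s = m -> coins s = w ->
  exists t s', [/\ t <= B ^ e, exec (c d) s t s' &
    [/\ forall x, x < d -> reg s' x = reg s x,
        memory s' = m' & coins s' = w']].

Definition cseq (c1 c2 : code) : code := fun d => c1 d ++ c2 d.
Definition cwrite (c1 c2 : code) : code :=
  fun d => c1 d ++ c2 d.+1 ++ [:: IWrite d d.+1].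
Definition cflip (c : code) : code :=
  fun d => c d ++ [:: IFlip d.+1; IWrite d d.+1].
(** The value sits in a register, so it survives changes to the memory cells it was computed
    from. *)
Definition clet (c : code) (body : code -> code) : code :=
  fun d => c d ++ body (cvar d) d.+1.
Definition cfor (n : code) (body : code -> code) : code :=
  fun d => n d ++ IConst d.+1 0 ::
    [:: IWhile d (body (cvar d.+1) d.+2 ++
          [:: IConst d.+2 1; IAdd d.+1 d.+1 d.+2; ISub d d d.+2])].

Lemma does_seq c1 c2 G m1 m2 m3 w1 w2 w3 e1 e2 :
  does c1 G m1 w1 m2 w2 e1 -> does c2 G m2 w2 m3 w3 e2 ->
  does (cseq c1 c2) G m1 w1 m3 w3 (maxn e1 e2).+1.
Proof.
move=> h1 h2 d s hG hm hw.
have [t1 [s1 [ht1 x1 [f1 hm1 hw1]]]] := h1 d s hG hm hw.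
have hG1 : extends G (d, reg s1).
  by apply: extends_trans hG _; split=> //= x hx; exact: f1.
have [t2 [s2 [ht2 x2 [f2 hm2 hw2]]]] := h2 d s1 hG1 hm1 hw1.
exists (t1 + t2), s2; split; last by split=> // x hx; rewrite f2 ?f1.
  by apply: (leq_trans (leq_add ht1 ht2)); rewrite -[X in X <= _]addn0 expB_add2.
exact: exec_cat x2.
Qed.

Lemma does_write c1 c2 G m w v1 v2 e1 e2 :
  evals m c1 G v1 e1 -> evals m c2 G v2 e2 ->
  does (cwrite c1 c2) G m w [eta m with v1 |-> v2] w (maxn e1 e2).+1.
Proof.
move=> h1 h2 d s hG hm hw.
have [t [s1 [ht x1 [ra rb f1 m1 k1]]]] := evals_two h1 h2 hG hm.
exists (t + 1), (State (reg s1) [eta m with v1 |-> v2] (coins s1)); split.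
- by apply: (leq_trans _ (expB_add2 e1 e2 (n := 1) _)) => //; rewrite leq_add2r.
- rewrite /cwrite catA; apply: exec_cat x1 _.
  by apply: exec_cons (exec_nil _) => k; rewrite /step /= ra rb m1.
by split=> //=; rewrite k1.
Qed.

Lemma does_flip c G m w v e :
  evals m c G v e ->
  does (cflip c) G m w [eta m with v |-> nat_of_bool (head false w)] (behead w) e.+1.
Proof.
move=> h d s hG hm hw.
have [t [s1 [ht x1 [ra f1 m1 k1]]]] := h d s hG hm.
exists (t + 2), (State [eta reg s1 with d.+1 |-> nat_of_bool (head false w)]
   [eta m with v |-> nat_of_bool (head false w)] (behead w)); split.
- have := @expB_add2 e e 1 isT; rewrite maxnn.
  have := expn_gt0 B e; rewrite B1 /=; lia.
- apply: exec_cat x1 _.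
  apply: exec_cons; first by move=> ?; rewrite /step /=; exact: erefl.
  apply: exec_cons (exec_nil _) => k; rewrite /step /= eqxx.
  by rewrite eqn_leq ltnn andbF ra m1 k1 hw.
split=> //= x hx; case: eqP => [|_]; first lia.
exact: f1.
Qed.

Lemma does_let c body G m w m' w' v e1 e2 :
  evals m c G v e1 ->
  (forall G' cv, extends G G' -> (forall m2, evals m2 cv G' v 1) ->
     does (body cv) G' m w m' w' e2) ->
  does (clet c body) G m w m' w' (maxn e1 e2).+1.
Proof.
move=> h1 h2 d s hG hm hw.
have [t [s1 [ht x1 [ra f1 m1 k1]]]] := h1 d s hG hm.
have hG1 : extends G (d.+1, reg s1).
  by apply: extends_trans hG _; split=> //= x hx; exact: f1.
have hv m2 : evals m2 (cvar d) (d.+1, reg s1) v 1.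
  by rewrite -ra; exact: (evals_var _ (G := (d.+1, reg s1))).
have [t2 [s2 [ht2 x2 [f2 hm2 hw2]]]] :=
  h2 _ _ hG1 hv d.+1 s1 (extends_refl _) m1 (etrans k1 hw).
exists (t + t2), s2; split.
- by apply: (leq_trans (leq_add ht ht2)); rewrite -[X in X <= _]addn0 expB_add2.
- exact: exec_cat x2.
by split=> // x hx; rewrite f2 ?f1 // ltnW.
Qed.

Lemma does_for n body G (N : nat) (M : nat -> nat -> nat) (W : nat -> seq bool)
    en eb :
  N <= B -> evals (M 0) n G N en ->
  (forall j G' cj, j < N -> extends G G' -> (forall m2, evals m2 cj G' j 1) ->
     does (body cj) G' (M j) (W j) (M j.+1) (W j.+1) eb) ->
  does (cfor n body) G (M 0) (W 0) (M N) (W N) (maxn en eb).+2.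
Proof.
move=> NB hn hb d s hG hm hw.
have [t1 [s1 [ht1 x1 [r1 f1 m1 k1]]]] := hn d s hG hm.
have main : forall j s3, j <= N -> reg s3 d = j -> reg s3 d.+1 = N - j ->
    memory s3 = M (N - j) -> coins s3 = W (N - j) ->
    (forall x, x < d -> reg s3 x = reg s x) ->
    exists t s', [/\ t <= j * (B ^ eb + 4) + 1,
      exec [:: IWhile d (body (cvar d.+1) d.+2 ++
          [:: IConst d.+2 1; IAdd d.+1 d.+1 d.+2; ISub d d d.+2])] s3 t s' &
     [/\ forall x, x < d -> reg s' x = reg s x,
        memory s' = M N & coins s' = W N]].
  elim=> [|j IH] s3 hj ra rb hm3 hc hf.
    exists 1, s3; split=> //; first exact: exec_while0.
    by rewrite hm3 hc subn0.
  have hG3 : extends G (d.+2, reg s3).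
    apply: extends_trans hG _; split=> /= [|x hx]; first by lia.
    exact: hf.
  have hlt : N - j.+1 < N by lia.
  have hv1 m2 : evals m2 (cvar d.+1) (d.+2, reg s3) (N - j.+1) 1.
    by rewrite -rb; exact: (evals_var _ (G := (d.+2, reg s3))).
  have [t4 [s4 [ht4 x4 [f4 m4 k4]]]] :=
    hb _ _ _ hlt hG3 hv1 d.+2 s3 (extends_refl _) hm3 hc.
  have e1 : (N - j.+1).+1 = N - j by lia.
  pose s5 := set_reg (set_reg (set_reg s4 d.+2 1) d.+1 (N - j)) d j.
  have x5 : exec [:: IConst d.+2 1; IAdd d.+1 d.+1 d.+2; ISub d d d.+2] s4 3 s5.
    do 3![apply: exec_cons; first by move=> ?; rewrite /step /=; exact: erefl].
    move=> k /=; congr (_, _); rewrite /s5 /set_reg /=.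
    have n1 x : ((x.+1 == x) = false) * ((x == x.+1) = false) by split; lia.
    have n2 x : ((x.+2 == x) = false) * ((x == x.+2) = false) by split; lia.
    rewrite !eqxx ?eqSS ?(n1, n2) (f4 d.+1) // (f4 d) // ra rb.
    by rewrite addn1 e1 subn1.
  have [] := IH s5; rewrite /s5 /=.
  - lia.
  - by rewrite !eqxx.
  - by rewrite !eqxx; case: eqP; first lia.
  - by rewrite m4 e1.
  - by rewrite k4 e1.
  - move=> x hx; do 3![case: eqP; first lia; move=> _].
    by rewrite f4 ?hf //; lia.
  move=> t6 [s6 [ht6 x6 post]]; exists (t4 + 3 + t6).+1, s6; split=> //.
  - by rewrite mulSn; lia.
  - apply: exec_while x6; first by rewrite ra.
    exact: exec_cat x5.
have [] := main N (set_reg s1 d.+1 0); rewrite ?subnn //=.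
- by case: eqP => //; lia.
- by rewrite eqxx.
- by rewrite k1 hw.
- by move=> x hx; rewrite f1 //; case: eqP => //; lia.
move=> t3 [s3 [ht3 x3 post]]; exists (t1 + t3.+1), s3; split=> //.
  set e := maxn en eb.
  have hen : B ^ en <= B ^ e by rewrite leq_pexp2l // /e; lia.
  have heb : B ^ eb <= B ^ e by rewrite leq_pexp2l // /e; lia.
  have h0 : 0 < B ^ e by rewrite expn_gt0 B1.
  have h1 : N * (B ^ eb + 4) <= B * (B ^ e + 4) by rewrite leq_mul ?leq_add2r.
  have h2 : B * 20 * B ^ e <= B * B * B ^ e by rewrite leq_mul2r leq_mul2l B20 !orbT.
  have h3 : B <= B * B ^ e by rewrite leq_pmulr.
  have h4 : B ^ e <= B * B ^ e by rewrite leq_pmull.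
  rewrite !expnS mulnA; lia.
apply: exec_cat x1 _.
by apply: exec_cons; first by move=> ?; rewrite /step /=; exact: erefl.
Qed.

(** * Arithmetic, comparison and bounded search from addition and subtraction *)

Lemma evals_le m c G v e e' : e <= e' -> evals m c G v e -> evals m c G v e'.
Proof.
move=> he h d s hG hm; have [t [s' [ht h1 h2]]] := h d s hG hm.
by exists t, s'; split=> //; apply: (leq_trans ht); rewrite leq_pexp2l.
Qed.

Definition cmul (c1 c2 : code) : code :=
  citer c2 (ccst 0) (fun _ acc => cadd acc c1).
Definition cleq (c1 c2 : code) : code := csub (ccst 1) (csub c1 c2).
Definition ceq (c1 c2 : code) : code := cmul (cleq c1 c2) (cleq c2 c1).
(** A conditional without branching: both alternatives are always evaluated, so each must meet its
    size bounds whatever the condition is. *)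
Definition cif (c c1 c2 : code) : code :=
  cadd (cmul c1 c) (cmul c2 (csub (ccst 1) c)).
Definition cexp (c1 c2 : code) : code :=
  citer c2 (ccst 1) (fun _ acc => cmul acc c1).
Definition call (n : code) (P : code -> code) : code :=
  citer n (ccst 1) (fun j acc => cmul acc (P j)).
Definition csearch (n : code) (P : code -> code) : code :=
  citer n (ccst 0) (fun _ acc => cadd acc (csub (ccst 1) (P acc))).
Definition cdiv (c1 c2 : code) : code :=
  csearch c1 (fun z => csub (ccst 1) (cleq (cmul c2 (cadd z (ccst 1))) c1)).
Definition cmod (c1 c2 : code) : code := csub c1 (cmul c2 (cdiv c1 c2)).
Definition cmem (k : nat) : code := cread (ccst k).

Lemma evals_mul m c1 c2 G v1 v2 e1 e2 : v2 <= B ->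
  evals m c1 G v1 e1 -> evals m c2 G v2 e2 ->
  evals m (cmul c1 c2) G (v1 * v2) (maxn e1 e2 + 4).
Proof.
move=> hv h1 h2.
apply: (@evals_le _ _ _ _ (maxn (maxn e2 0) (maxn 1 e1).+1).+2); first lia.
apply: (evals_iter (F := muln v1)) => // [|j G' cj ca hj hG _ hca].
  by rewrite muln0; exact: evals_cst.
by rewrite mulnSr; apply: evals_add => //; exact: evals_extends h1.
Qed.

Lemma evals_leq m c1 c2 G v1 v2 e1 e2 :
  evals m c1 G v1 e1 -> evals m c2 G v2 e2 ->
  evals m (cleq c1 c2) G (v1 <= v2) (maxn e1 e2).+2.
Proof.
move=> h1 h2.
have -> : nat_of_bool (v1 <= v2) = 1 - (v1 - v2).
  by case: leqP => h /=; lia.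
apply: (@evals_le _ _ _ _ (maxn 0 (maxn e1 e2).+1).+1); first lia.
by apply: evals_sub; [exact: evals_cst|exact: evals_sub].
Qed.

Lemma evals_eq m c1 c2 G v1 v2 e1 e2 :
  evals m c1 G v1 e1 -> evals m c2 G v2 e2 ->
  evals m (ceq c1 c2) G (v1 == v2) (maxn e1 e2 + 6).
Proof.
move=> h1 h2; rewrite eqn_leq -mulnb.
apply: (@evals_le _ _ _ _ (maxn (maxn e1 e2).+2 (maxn e2 e1).+2 + 4)); first lia.
apply: evals_mul; [exact: leq_trans (leq_b1 _) B1|exact: evals_leq|exact: evals_leq].
Qed.

Lemma evals_if m c c1 c2 G (v : bool) v1 v2 e e1 e2 :
  evals m c G v e -> evals m c1 G v1 e1 -> evals m c2 G v2 e2 ->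
  evals m (cif c c1 c2) G (if v then v1 else v2) (maxn e (maxn e1 e2) + 6).
Proof.
move=> h h1 h2.
have -> : (if v then v1 else v2) = v1 * v + v2 * (1 - v) by case: v {h}; lia.
apply: (@evals_le _ _ _ _ (maxn (maxn e1 e + 4) (maxn e2 (maxn 0 e).+1 + 4)).+1).
  lia.
apply: evals_add; apply: evals_mul => //; try by case: (v); rewrite ?B1.
by apply: evals_sub => //; exact: evals_cst.
Qed.

Lemma evals_exp m c1 c2 G v1 v2 e1 e2 : v1 <= B -> v2 <= B ->
  evals m c1 G v1 e1 -> evals m c2 G v2 e2 ->
  evals m (cexp c1 c2) G (v1 ^ v2) (maxn e1 e2 + 7).
Proof.
move=> hv1 hv2 h1 h2.
apply: (@evals_le _ _ _ _ (maxn (maxn e2 0) (maxn 1 e1 + 4)).+2); first lia.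
apply: (evals_iter (F := expn v1)) => // [|j G' cj ca hj hG _ hca].
  by rewrite expn0; exact: evals_cst.
by rewrite expnSr; apply: evals_mul => //; exact: evals_extends h1.
Qed.

Lemma evals_all m n P G N (p : nat -> bool) en eb : N <= B ->
  evals m n G N en ->
  (forall j G' cj, j < N -> extends G G' -> evals m cj G' j 1 ->
     evals m (P cj) G' (p j) eb) ->
  evals m (call n P) G (all p (iota 0 N)) (maxn en eb + 7).
Proof.
move=> hN hn hP.
apply: (@evals_le _ _ _ _ (maxn (maxn en 0) (maxn 1 eb + 4)).+2); first lia.
apply: (evals_iter (F := fun j => nat_of_bool (all p (iota 0 j)))) => //.
  exact: evals_cst.
move=> j G' cj ca hj hG hcj hca.
rewrite -addn1 iotaD all_cat /= andbT add0n -mulnb.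
by apply: evals_mul => //; [exact: leq_trans (leq_b1 _) B1|exact: hP].
Qed.

(* The least [z <= N] such that [P z], provided there is one. *)
Definition search (P : pred nat) (N : nat) : nat :=
  iteri N (fun _ z => z + ~~ P z) 0.

Lemma search_le (P : pred nat) N : search P N <= N.
Proof. by elim: N => //= N IH; case: (P _) => /=; rewrite /search in IH *; lia. Qed.

Lemma search_min (P : pred nat) N z : z < search P N -> ~~ P z.
Proof.
rewrite /search; elim: N => //= N IH.
case: (boolP (P _)) => h /=; rewrite ?addn0 // addn1 ltnS leq_eqVlt.
by case/predU1P => [->|/IH].
Qed.

(** If the final candidate failed, it was increased in every round and equals [N], so every value up
    to [N] fails. *)
Lemma searchP (P : pred nat) N z : P z -> z <= N -> P (search P N).
Proof.
move=> Pz zN.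
have [//|nP] := boolP (P (search P N)).
suff e : search P N = N.
  have : z < search P N -> ~~ P z := @search_min P N z.
  rewrite e Pz; rewrite leq_eqVlt in zN.
  case/predU1P: zN => [zN|/[swap]/[apply]//].
  by move: nP; rewrite e -zN Pz.
elim: N nP {z Pz zN} => //= N IH.
rewrite {1 2}/search /= -/(search P N).
by case: (boolP (P (search P N))) => [h|/IH ->]; rewrite ?addn0 ?h // addn1.
Qed.

Lemma evals_search m n P G N (p : pred nat) en eb : N <= B ->
  evals m n G N en ->
  (forall z G' cz, z < N -> extends G G' -> evals m cz G' z 1 ->
     evals m (P cz) G' (p z) eb) ->
  evals m (csearch n P) G (search p N) (maxn en eb + 5).
Proof.
move=> hN hn hP.
apply: (@evals_le _ _ _ _ (maxn (maxn en 0) (maxn 1 (maxn 0 eb).+1).+1).+2).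
  lia.
apply: (evals_iter (F := search p)) => // [|j G' cj ca hj hG _ hca].
  exact: evals_cst.
rewrite /search /= -/(search p j); apply: evals_add => //.
have -> : nat_of_bool (~~ p (search p j)) = 1 - p (search p j) by case: (p _).
apply: evals_sub; first exact: evals_cst.
by apply: hP => //; exact: leq_ltn_trans (search_le _ _) hj.
Qed.

Lemma search_div x y : 0 < y -> search (fun z => ~~ (y * (z + 1) <= x)) x = x %/ y.
Proof.
move=> hy; set p := fun z => _.
have pd : p (x %/ y).
  by rewrite /p -ltnNge mulnC addn1 ltn_ceil.
apply/eqP; rewrite eqn_leq; apply/andP; split; last first.
  rewrite leqNgt; apply/negP => h.
  have := searchP pd (leq_div _ _); rewrite {1}/p => /negP; apply.
  apply: leq_trans (leq_trunc_div x y).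
  by rewrite mulnC leq_mul2r addn1 h orbT.
by rewrite leqNgt; apply/negP => /search_min; rewrite pd.
Qed.

Lemma evals_div m c1 c2 G v1 v2 e1 e2 : 0 < v2 -> v1 <= B ->
  evals m c1 G v1 e1 -> evals m c2 G v2 e2 ->
  evals m (cdiv c1 c2) G (v1 %/ v2) (maxn e1 e2 + 15).
Proof.
move=> hv2 hv1 h1 h2; rewrite -search_div //.
apply: (@evals_le _ _ _ _
  (maxn e1 (maxn 0 (maxn (maxn e2 (maxn 1 0).+1 + 4) e1).+2).+1 + 5)); first lia.
apply: evals_search => // z G' cz hz hG hcz.
have -> b : nat_of_bool (~~ b) = 1 - b by case: b.
apply: evals_sub; first exact: evals_cst.
apply: evals_leq; last exact: evals_extends h1.
apply: evals_mul; [lia|exact: evals_extends h2|].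
by apply: evals_add => //; exact: evals_cst.
Qed.

Lemma evals_mod m c1 c2 G v1 v2 e1 e2 : 0 < v2 -> v1 <= B ->
  evals m c1 G v1 e1 -> evals m c2 G v2 e2 ->
  evals m (cmod c1 c2) G (v1 %% v2) (maxn e1 e2 + 20).
Proof.
move=> hv2 hv1 h1 h2.
have -> : v1 %% v2 = v1 - v2 * (v1 %/ v2) by rewrite {2}(divn_eq v1 v2); lia.
apply: (@evals_le _ _ _ _
  (maxn e1 (maxn e2 (maxn e1 e2 + 15) + 4)).+1); first lia.
apply: evals_sub => //; apply: evals_mul => //; last exact: evals_div.
exact: leq_trans (leq_div _ _) hv1.
Qed.

Lemma evals_mem m k G : evals m (cmem k) G (m k) 1.
Proof. by apply: evals_read; exact: evals_cst. Qed.

(** * The reduction program *)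

Definition digit (base c i : nat) : nat := (c %/ base ^ i) %% base.

Definition cdigit (cb cc ci : code) : code := cmod (cdiv cc (cexp cb ci)) cb.

Lemma evals_digit m cb cc ci G base c i eb ec ei :
  0 < base -> base <= B -> c <= B -> i <= B ->
  evals m cb G base eb -> evals m cc G c ec -> evals m ci G i ei ->
  evals m (cdigit cb cc ci) G (digit base c i) (maxn eb (maxn ec ei) + 42).
Proof.
move=> hb hB hc hi h1 h2 h3.
apply: (@evals_le _ _ _ _ (maxn (maxn ec (maxn eb ei + 7) + 15) eb + 20)).
  lia.
apply: evals_mod => //; first exact: leq_trans (leq_div _ _) hc.
by apply: evals_div => //; [rewrite expn_gt0 hb|exact: evals_exp].
Qed.

Section Program.

(* The reduction only needs the following data about an instance: the integer
   standing for 1/delta, the sizes |A|, |B|, |Sigma|, |E|, the end points of the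
   [e]-th edge and its projection, and the stream of random bits. *)
Variables md a b s E : nat.
Variables (ea eb : nat -> nat) (tab : nat -> nat -> nat) (bit : nat -> nat).

Definition nv := a + b.
Definition sqrt_nv := search (fun z => nv <= z * z) nv.
(** For [1 < nv] this is the ceiling of [sqrt_nv / log2 nv]; comparing integer powers avoids
    computing a logarithm. *)
Definition nblocks := search (fun z => 2 ^ sqrt_nv <= nv ^ z) sqrt_nv.
Definition bsize := search (fun z => a <= nblocks * z) a.
Definition ntest := 24 * md * nblocks.
Definition lbits := search (fun z => b <= 2 ^ z) b.
Definition nassign := s ^ bsize.
Definition gsize := nblocks + nassign * nblocks.
Definition nlists := 2 ^ nblocks.
Definition ndigits := s ^ (nblocks + ntest).
Definition nconcepts := ndigits * nlists.
Definition nout := 2 + nconcepts * gsize.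
(** Memory layout: the input, then the random bits from [tbase] on, then a draft of the output from
    [obase] on. *)
Definition tbase := 5 + (s + 2) * E.
Definition nbits := nlists * ntest * lbits.
Definition obase := tbase + nbits.

(** The bits are read most significant first. The value may be [b] or more; it then names no vertex
    and the test imposes no condition. *)
Definition test (H j : nat) : nat :=
  iteri lbits (fun i acc => acc + acc + bit ((H * ntest + j) * lbits + i)) 0.

(* The ground elements [x < nblocks] select the list of tests; the other ones
   are the pairs of a block [i] and an assignment [t] to its [bsize] slots, the
   [t]-th slot of block [i] being the vertex [(i * bsize + t) %% a]. *)
Definition checks (H d i t : nat) : bool :=
  all (fun u => all (fun e => all (fun j =>
        (ea e == (i * bsize + u) %% a) && (eb e == test H j)
          ==> (tab e (digit s t u) == digit s d (nblocks + j)))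
     (iota 0 ntest)) (iota 0 E)) (iota 0 bsize).

(** The index [c] packs the list [H] and a number [d]. In base [s], a nonzero digit among the first
    [nblocks] digits of [d] puts that block into the set I, and the following [ntest] digits are the
    labels at the tested vertices. *)
Definition member (c x : nat) : bool :=
  let H := c %% nlists in let d := c %/ nlists in
  if x < nblocks then 0 < digit 2 H x else
  let i := (x - nblocks) %/ nassign in
  (0 < digit s d i) && checks H d i ((x - nblocks) %% nassign).

Definition cell (z : nat) : nat :=
  if z == 0 then gsize else
  if z == 1 then nconcepts else member ((z - 2) %/ gsize) ((z - 2) %% gsize).

(** * The same quantities as programs *)

Definition c_nv := cadd (cmem 1) (cmem 2).
Definition c_sqrt := csearch c_nv (fun z => cleq c_nv (cmul z z)).
Definition c_nblocks :=
  csearch c_sqrt (fun z => cleq (cexp (ccst 2) c_sqrt) (cexp c_nv z)).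
Definition c_bsize := csearch (cmem 1) (fun z => cleq (cmem 1) (cmul c_nblocks z)).
Definition c_ntest := cmul (cmul (ccst 24) (cmem 0)) c_nblocks.
Definition c_lbits := csearch (cmem 2) (fun z => cleq (cmem 2) (cexp (ccst 2) z)).
Definition c_nassign := cexp (cmem 3) c_bsize.
Definition c_gsize := cadd c_nblocks (cmul c_nassign c_nblocks).
Definition c_nlists := cexp (ccst 2) c_nblocks.
Definition c_ndigits := cexp (cmem 3) (cadd c_nblocks c_ntest).
Definition c_nconcepts := cmul c_ndigits c_nlists.
Definition c_nout := cadd (ccst 2) (cmul c_nconcepts c_gsize).
Definition c_tbase := cadd (ccst 5) (cmul (cadd (cmem 3) (ccst 2)) (cmem 4)).
Definition c_nbits := cmul (cmul c_nlists c_ntest) c_lbits.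
Definition c_obase := cadd c_tbase c_nbits.

Definition c_test (H j : code) :=
  citer c_lbits (ccst 0) (fun i acc => cadd (cadd acc acc)
    (cread (cadd c_tbase
      (cadd (cmul (cadd (cmul H c_ntest) j) c_lbits) i)))).

Definition c_edge e := cadd (ccst 5) (cmul (cadd (cmem 3) (ccst 2)) e).

Definition c_checks (H d i t : code) :=
  call c_bsize (fun u => call (cmem 4) (fun e => call c_ntest (fun j =>
    cleq (cmul (ceq (cread (c_edge e)) (cmod (cadd (cmul i c_bsize) u) (cmem 1)))
               (ceq (cread (cadd (c_edge e) (ccst 1))) (c_test H j)))
         (ceq (cread (cadd (cadd (c_edge e) (ccst 2)) (cdigit (cmem 3) t u)))
              (cdigit (cmem 3) d (cadd c_nblocks j)))))).

Definition c_member (c x : code) :=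
  let H := cmod c c_nlists in let d := cdiv c c_nlists in
  let y := csub x c_nblocks in let i := cdiv y c_nassign in
  cif (cleq (cadd x (ccst 1)) c_nblocks)
      (cleq (ccst 1) (cdigit (ccst 2) H x))
      (cmul (cleq (ccst 1) (cdigit (cmem 3) d i))
            (c_checks H d i (cmod y c_nassign))).

Definition c_cell (z : code) :=
  let y := csub z (ccst 2) in
  cif (ceq z (ccst 0)) c_gsize
   (cif (ceq z (ccst 1)) c_nconcepts (c_member (cdiv y c_gsize) (cmod y c_gsize))).

(** The output has to start in the cells of the input, which are read until the last output cell is
    known. So a draft is written higher up and copied down at the end, with [obase] computed before
    the copying destroys the cells it depends on. *)
Definition c_reduction : code :=
  cseq (cfor c_nbits (fun z => cflip (cadd c_tbase z)))
  (cseq (cfor c_nout (fun z => cwrite (cadd c_obase z) (c_cell z)))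
    (clet c_obase (fun o =>
      cfor c_nout (fun z => cwrite z (cread (cadd o z)))))).

Hypotheses (a_gt0 : 0 < a) (s_gt0 : 0 < s) (nblocks_gt0 : 0 < nblocks).
Hypotheses (mdB : md <= B) (nvB : nv <= B) (sB : s <= B) (EB : E <= B).
Hypotheses (slotsB : nblocks * bsize <= B) (digitsB : nblocks + ntest <= B).
Hypotheses (outB : nout <= B) (bitsB : nbits <= B).

Lemma nassign_gt0 : 0 < nassign. Proof. by rewrite expn_gt0 s_gt0. Qed.
Lemma nlists_gt0 : 0 < nlists. Proof. by rewrite expn_gt0. Qed.
Lemma ndigits_gt0 : 0 < ndigits. Proof. by rewrite expn_gt0 s_gt0. Qed.
Lemma nconcepts_gt0 : 0 < nconcepts.
Proof. by rewrite muln_gt0 ndigits_gt0 nlists_gt0. Qed.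
Lemma gsize_gt0 : 0 < gsize. Proof. by rewrite addn_gt0 nblocks_gt0. Qed.

Lemma nblocksB : nblocks <= B. Proof. exact: leq_trans (leq_addr _ _) digitsB. Qed.
Lemma ntestB : ntest <= B. Proof. exact: leq_trans (leq_addl _ _) digitsB. Qed.
Lemma aB : a <= B. Proof. exact: leq_trans (leq_addr _ _) nvB. Qed.
Lemma bB : b <= B. Proof. exact: leq_trans (leq_addl _ _) nvB. Qed.
Lemma bsizeB : bsize <= B. Proof. exact: leq_trans (search_le _ _) aB. Qed.
Lemma lbitsB : lbits <= B. Proof. exact: leq_trans (search_le _ _) bB. Qed.
Lemma sqrtB : sqrt_nv <= B. Proof. exact: leq_trans (search_le _ _) nvB. Qed.
Lemma gsizeB : gsize <= B.
Proof.
apply: leq_trans outB; have := leq_pmull gsize nconcepts_gt0; rewrite /nout; lia.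
Qed.
Lemma nconceptsB : nconcepts <= B.
Proof.
apply: leq_trans outB; have := leq_pmulr nconcepts gsize_gt0; rewrite /nout; lia.
Qed.
Lemma nlistsB : nlists <= B.
Proof. by apply: leq_trans nconceptsB; exact: leq_pmull ndigits_gt0. Qed.
Lemma B2 : 2 <= B. Proof. exact: leq_trans B20. Qed.

Definition is_input (m : nat -> nat) : Prop :=
  [/\ [/\ m 0 = md, m 1 = a, m 2 = b, m 3 = s & m 4 = E],
      forall e, e < E -> m (5 + (s + 2) * e) = ea e,
      forall e, e < E -> m (5 + (s + 2) * e + 1) = eb e
    & forall e x, e < E -> x < s -> m (5 + (s + 2) * e + 2 + x) = tab e x].

Definition is_random (m : nat -> nat) : Prop :=
  forall z, z < nbits -> m (tbase + z) = bit z.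

(** * Values and running times of the programs *)

Section Params.
Variables (m : nat -> nat) (G : ctx).
Hypothesis hm : is_input m.

Lemma evals_md : evals m (cmem 0) G md 1.
Proof. by case: hm => -[<- _ _ _ _] _ _ _; exact: evals_mem. Qed.
Lemma evals_a : evals m (cmem 1) G a 1.
Proof. by case: hm => -[_ <- _ _ _] _ _ _; exact: evals_mem. Qed.
Lemma evals_b : evals m (cmem 2) G b 1.
Proof. by case: hm => -[_ _ <- _ _] _ _ _; exact: evals_mem. Qed.
Lemma evals_s : evals m (cmem 3) G s 1.
Proof. by case: hm => -[_ _ _ <- _] _ _ _; exact: evals_mem. Qed.
Lemma evals_E : evals m (cmem 4) G E 1.
Proof. by case: hm => -[_ _ _ _ <-] _ _ _; exact: evals_mem. Qed.
Lemma evals_nv : evals m c_nv G nv 2.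
Proof. exact: (evals_add evals_a evals_b). Qed.
End Params.

Lemma evals_sqrt m G : is_input m -> evals m c_sqrt G sqrt_nv 20.
Proof.
(* The exponent is left open, is assembled by the rules for the subprograms, and is compared with
   the stated one at the end. *)
move=> hm; apply: evals_le; last first.
  apply: evals_search; [exact: nvB|exact: evals_nv|move=> z G' cz hz hG hcz].
  apply: evals_leq; first exact: evals_nv.
  by apply: evals_mul; [exact: leq_trans (ltnW hz) nvB|exact: hcz|exact: hcz].
by [].
Qed.

Lemma evals_nblocks m G : is_input m -> evals m c_nblocks G nblocks 40.
Proof.
move=> hm; apply: evals_le; last first.
  apply: evals_search; [exact: sqrtB|exact: evals_sqrt|move=> z G' cz hz hG hcz].
  apply: evals_leq.
    apply: evals_exp; [exact: B2|exact: sqrtB|exact: evals_cst|exact: evals_sqrt].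
  apply: evals_exp; [exact: nvB| |exact: evals_nv|exact: hcz].
  exact: leq_trans (ltnW hz) sqrtB.
by [].
Qed.

Lemma evals_bsize m G : is_input m -> evals m c_bsize G bsize 60.
Proof.
move=> hm; apply: evals_le; last first.
  apply: evals_search; [exact: aB|exact: evals_a|move=> z G' cz hz hG hcz].
  apply: evals_leq; first exact: evals_a.
  apply: evals_mul; [|exact: evals_nblocks|exact: hcz].
  exact: leq_trans (ltnW hz) aB.
by [].
Qed.

Lemma evals_ntest m G : is_input m -> evals m c_ntest G ntest 60.
Proof.
move=> hm; apply: evals_le; last first.
  apply: evals_mul; [exact: nblocksB| |exact: evals_nblocks].
  by apply: evals_mul; [exact: mdB|exact: evals_cst|exact: evals_md].
by [].
Qed.

Lemma evals_lbits m G : is_input m -> evals m c_lbits G lbits 60.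
Proof.
move=> hm; apply: evals_le; last first.
  apply: evals_search; [exact: bB|exact: evals_b|move=> z G' cz hz hG hcz].
  apply: evals_leq; first exact: evals_b.
  apply: evals_exp; [exact: B2| |exact: evals_cst|exact: hcz].
  exact: leq_trans (ltnW hz) bB.
by [].
Qed.

Lemma evals_nassign m G : is_input m -> evals m c_nassign G nassign 70.
Proof.
move=> hm; apply: evals_le; last first.
  by apply: evals_exp; [exact: sB|exact: bsizeB|exact: evals_s|exact: evals_bsize].
by [].
Qed.

Lemma evals_gsize m G : is_input m -> evals m c_gsize G gsize 80.
Proof.
move=> hm; apply: evals_le; last first.
  apply: evals_add; first exact: evals_nblocks.
  by apply: evals_mul; [exact: nblocksB|exact: evals_nassign|exact: evals_nblocks].
by [].
Qed.

Lemma evals_nlists m G : is_input m -> evals m c_nlists G nlists 60.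
Proof.
move=> hm; apply: evals_le; last first.
  by apply: evals_exp; [exact: B2|exact: nblocksB|exact: evals_cst|exact: evals_nblocks].
by [].
Qed.

Lemma evals_nconcepts m G : is_input m -> evals m c_nconcepts G nconcepts 80.
Proof.
move=> hm; apply: evals_le; last first.
  apply: evals_mul; [exact: nlistsB| |exact: evals_nlists].
  apply: evals_exp; [exact: sB|exact: digitsB|exact: evals_s|].
  by apply: evals_add; [exact: evals_nblocks|exact: evals_ntest].
by [].
Qed.

Lemma evals_nout m G : is_input m -> evals m c_nout G nout 90.
Proof.
move=> hm; apply: evals_le; last first.
  apply: evals_add; first exact: evals_cst.
  by apply: evals_mul; [exact: gsizeB|exact: evals_nconcepts|exact: evals_gsize].
by [].
Qed.

Lemma evals_edge m G ce e k : is_input m -> e <= E ->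
  evals m ce G e k -> evals m (c_edge ce) G (5 + (s + 2) * e) (maxn 2 k + 5).
Proof.
move=> hm he hce; apply: evals_le; last first.
  apply: evals_add; first exact: evals_cst.
  apply: evals_mul; [exact: leq_trans EB| |exact: hce].
  by apply: evals_add; [exact: evals_s|exact: evals_cst].
lia.
Qed.

Lemma evals_tbase m G : is_input m -> evals m c_tbase G tbase 60.
Proof.
move=> hm; apply: evals_le; last first.
  by apply: (@evals_edge m G (cmem 4) E 1 hm (leqnn _)); exact: evals_E.
by [].
Qed.

Lemma evals_nbits m G : is_input m -> evals m c_nbits G nbits 80.
Proof.
move=> hm; apply: evals_le; last first.
  apply: evals_mul; [exact: lbitsB| |exact: evals_lbits].
  by apply: evals_mul; [exact: ntestB|exact: evals_nlists|exact: evals_ntest].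
by [].
Qed.

Lemma evals_obase m G : is_input m -> evals m c_obase G obase 81.
Proof.
move=> hm; apply: evals_le; last first.
  by apply: evals_add; [exact: evals_tbase|exact: evals_nbits].
by [].
Qed.

Lemma evals_test m G cH cj H j : is_input m -> is_random m ->
  H < nlists -> j < ntest ->
  evals m cH G H 180 -> evals m cj G j 1 -> evals m (c_test cH cj) G (test H j) 200.
Proof.
move=> hm hr hH hj h1 h2; apply: evals_le; last first.
  apply: (evals_iter (N := lbits) (F := fun n =>
    iteri n (fun i acc => acc + acc + bit ((H * ntest + j) * lbits + i)) 0));
    [exact: lbitsB|exact: evals_lbits|exact: evals_cst|].
  move=> i G' ci ca hi hG hci hca /=; apply: evals_add.
    by apply: evals_add; exact: hca.
  rewrite -hr; last first.
    have h3 : H * ntest + j < nlists * ntest.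
      apply: (@leq_trans (H.+1 * ntest)); first by rewrite mulSn; lia.
      by rewrite leq_mul2r hH orbT.
    apply: (@leq_trans ((H * ntest + j).+1 * lbits)); first by rewrite mulSn; lia.
    by rewrite /nbits leq_mul2r h3 orbT.
  apply: evals_read; apply: evals_add; first exact: evals_tbase.
  apply: evals_add; last exact: hci.
  apply: evals_mul; [exact: lbitsB| |exact: evals_lbits].
  apply: evals_add; last exact: evals_extends h2.
  apply: evals_mul; [exact: ntestB|exact: evals_extends h1|exact: evals_ntest].
by [].
Qed.

Lemma evals_checks m G cH cd ci ct H d i t : is_input m -> is_random m ->
  H < nlists -> i < nblocks -> d <= B -> t <= B ->
  evals m cH G H 180 -> evals m cd G d 180 -> evals m ci G i 180 ->
  evals m ct G t 180 ->
  evals m (c_checks cH cd ci ct) G (checks H d i t) 300.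
Proof.
move=> hm hr hH hi hd ht h1 h2 h3 h4; apply: evals_le; last first.
  apply: evals_all; [exact: bsizeB|exact: evals_bsize|].
  move=> u G1 cu hu hG1 hcu.
  apply: evals_all; [exact: EB|exact: evals_E|].
  move=> e G2 ce he hG2 hce.
  apply: evals_all; [exact: ntestB|exact: evals_ntest|].
  move=> j G3 cj hj hG3 hcj.
  have hGG : extends G G3 by apply: extends_trans hG3; exact: extends_trans hG2.
  have hu3 : evals m cu G3 u 1.
    by apply: evals_extends hcu; exact: extends_trans hG3.
  have he3 : evals m ce G3 e 1 by exact: evals_extends hce.
  have hE3 := evals_edge hm (ltnW he) he3.
  (* An implication of booleans is an inequality between 0 and 1, which [cleq] computes. *)
  have imp p q : (p ==> q) = (nat_of_bool p <= nat_of_bool q) by case: p q => -[].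
  rewrite imp; apply: evals_leq.
    rewrite -mulnb; apply: evals_mul; first exact: leq_trans (leq_b1 _) B1.
      apply: evals_eq.
        case: (hm) => _ <- // _ _; apply: evals_read; exact: hE3.
      apply: evals_mod => //; last exact: evals_a.
        apply: leq_trans slotsB; apply: (@leq_trans (i.+1 * bsize)).
          by rewrite mulSn; lia.
        by rewrite leq_mul2r hi orbT.
      apply: evals_add; last exact: hu3.
      by apply: evals_mul; [exact: bsizeB|exact: evals_extends h3|exact: evals_bsize].
    apply: evals_eq.
      case: (hm) => _ _ <- // _; apply: evals_read.
      by apply: evals_add; [exact: hE3|exact: evals_cst].
    by apply: evals_test => //; exact: evals_extends h1.
  apply: evals_eq.
    case: (hm) => _ _ _ <- //; last by rewrite ltn_mod.
    apply: evals_read; apply: evals_add.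
      by apply: evals_add; [exact: hE3|exact: evals_cst].
    apply: evals_digit => //; last 3 first.
    - exact: evals_s.
    - exact: evals_extends h4.
    - exact: hu3.
    exact: leq_trans (ltnW hu) bsizeB.
  apply: evals_digit => //; last 3 first.
  - exact: evals_s.
  - exact: evals_extends h2.
  - by apply: evals_add; [exact: evals_nblocks|exact: hcj].
  by apply: leq_trans digitsB; rewrite leq_add2l ltnW.
by [].
Qed.

Lemma evals_member m G cc cx c x : is_input m -> is_random m ->
  c < nconcepts -> x < gsize ->
  evals m cc G c 125 -> evals m cx G x 125 ->
  evals m (c_member cc cx) G (member c x) 330.
Proof.
move=> hm hr hc hx h1 h2.
have cB : c <= B := leq_trans (ltnW hc) nconceptsB.
have xB : x <= B := leq_trans (ltnW hx) gsizeB.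
have hH : evals m (cmod cc c_nlists) G (c %% nlists) 145.
  by apply: (evals_mod (e1 := 125) (e2 := 125)); [exact: nlists_gt0|exact: cB|exact: h1|
    by refine (evals_le _ (evals_nlists hm))].
have hHl : c %% nlists < nlists by rewrite ltn_mod nlists_gt0.
have hd : evals m (cdiv cc c_nlists) G (c %/ nlists) 140.
  by apply: (evals_div (e1 := 125) (e2 := 125)); [exact: nlists_gt0|exact: cB|exact: h1|
    by refine (evals_le _ (evals_nlists hm))].
have dB : c %/ nlists <= B by exact: leq_trans (leq_div _ _) cB.
have hy : evals m (csub cx c_nblocks) G (x - nblocks) 126.
  by apply: (evals_sub (e1 := 125) (e2 := 125)); [exact: h2|
    by refine (evals_le _ (evals_nblocks hm))].
have yB : x - nblocks <= B by apply: leq_trans xB; rewrite leq_subr.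
have hi : evals m (cdiv (csub cx c_nblocks) c_nassign) G
    ((x - nblocks) %/ nassign) 141.
  by apply: (evals_div (e1 := 126) (e2 := 126)); [exact: nassign_gt0|exact: yB|exact: hy|
    by refine (evals_le _ (evals_nassign hm))].
(* This code is evaluated even for [x < nblocks]; truncated subtraction then leads to block 0, which
   exists. *)
have hil : (x - nblocks) %/ nassign < nblocks.
  have h0 : 0 < nassign * nblocks by rewrite muln_gt0 nassign_gt0.
  by rewrite ltn_divLR ?nassign_gt0 // mulnC; move: hx; rewrite /gsize; lia.
have ht : evals m (cmod (csub cx c_nblocks) c_nassign) G
    ((x - nblocks) %% nassign) 146.
  by apply: (evals_mod (e1 := 126) (e2 := 126)); [exact: nassign_gt0|exact: yB|exact: hy|
    by refine (evals_le _ (evals_nassign hm))].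
have tB : (x - nblocks) %% nassign <= B by exact: leq_trans (leq_mod _ _) yB.
rewrite /member; set p := _ && _.
rewrite (_ : nat_of_bool (if _ then _ else _) = if x < nblocks then
   nat_of_bool (0 < digit 2 (c %% nlists) x) else nat_of_bool p); last by case: ifP.
apply: evals_le; last first.
  apply: evals_if.
  - rewrite -(addn1 x); apply: evals_leq.
      by apply: evals_add; [exact: h2|exact: evals_cst].
    exact: evals_nblocks.
  - apply: evals_leq; first exact: evals_cst.
    apply: evals_digit; last 3 first.
    + exact: evals_cst.
    + exact: hH.
    + exact: h2.
    + by [].
    + exact: B2.
    + exact: leq_trans (leq_mod _ _) cB.
    + exact: xB.
  - rewrite /p -mulnb; apply: evals_mul; first exact: leq_trans (leq_b1 _) B1.
      apply: evals_leq; first exact: evals_cst.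
      apply: evals_digit; last 3 first.
      + exact: evals_s.
      + exact: hd.
      + exact: hi.
      + exact: s_gt0.
      + exact: sB.
      + exact: dB.
      + exact: leq_trans (ltnW hil) nblocksB.
    by apply: evals_checks => //; [by refine (evals_le _ hH)|by refine (evals_le _ hd)|
      by refine (evals_le _ hi)|by refine (evals_le _ ht)].
by [].
Qed.

Lemma evals_cell m G cz z : is_input m -> is_random m -> z < nout ->
  evals m cz G z 1 -> evals m (c_cell cz) G (cell z) 350.
Proof.
move=> hm hr hz h.
have zB : z <= B := leq_trans (ltnW hz) outB.
have hy : evals m (csub cz (ccst 2)) G (z - 2) 2.
  by apply: (evals_sub (e1 := 1) (e2 := 0)); [exact: h|exact: evals_cst].
have yB : z - 2 <= B by apply: leq_trans zB; rewrite leq_subr.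
apply: evals_le; last first.
  apply: evals_if.
  - by apply: evals_eq; [exact: h|exact: evals_cst].
  - exact: evals_gsize.
  apply: evals_if.
  - by apply: evals_eq; [exact: h|exact: evals_cst].
  - exact: evals_nconcepts.
  apply: evals_member => //.
  - rewrite ltn_divLR ?gsize_gt0 //; move: hz; rewrite /nout.
    have := nconcepts_gt0; have := gsize_gt0; nia.
  - by rewrite ltn_mod gsize_gt0.
  - apply: evals_le; last first.
      by apply: evals_div; [exact: gsize_gt0|exact: yB|exact: hy|exact: evals_gsize].
    by [].
  - apply: evals_le; last first.
      by apply: evals_mod; [exact: gsize_gt0|exact: yB|exact: hy|exact: evals_gsize].
    by [].
by [].
Qed.

(** * The memory during the run of the reduction *)

Lemma is_input_below m m' :
  is_input m -> (forall z, z < tbase -> m' z = m z) -> is_input m'.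
Proof.
have h5 : 5 <= tbase by exact: leq_addr.
have he e k : e < E -> k < s + 2 -> 5 + (s + 2) * e + k < tbase.
  move=> he hk; rewrite /tbase -addnA ltn_add2l.
  apply: (@leq_trans ((s + 2) * e.+1)); first by rewrite mulnS; lia.
  by rewrite leq_mul2l he orbT.
move=> [[m0 m1 m2 m3 m4] hea heb htab] hm'; split.
- by split; rewrite hm' //; exact: leq_trans h5.
- by move=> e h; rewrite hm' ?hea // -[X in X < _]addn0 he // addn2.
- by move=> e h; rewrite hm' ?heb // he // addn2.
- by move=> e x h hx; rewrite hm' ?htab // -addnA he //; lia.
Qed.

Definition updates (m : nat -> nat) (o n : nat) (f : nat -> nat) : nat -> nat :=
  fun z => if (o <= z) && (z < o + n) then f (z - o) else m z.

Lemma updates0 m o f : updates m o 0 f = m.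
Proof. by apply: functional_extensionality => z; rewrite /updates; case: ifP => //; lia. Qed.

Lemma updatesS m o n f :
  updates m o n.+1 f = [eta updates m o n f with o + n |-> f n].
Proof.
apply: functional_extensionality => z; rewrite /updates /=.
case: eqP => [->|hz]; last by congr (if _ then _ else _); lia.
by rewrite leq_addr addnS ltnS leqnn addKn.
Qed.

Lemma updates_below m o n f z : z < o -> updates m o n f z = m z.
Proof. by rewrite /updates; case: leqP. Qed.

Lemma updates_in m o n f z : z < n -> updates m o n f (o + z) = f z.
Proof. by move=> h; rewrite /updates leq_addr ltn_add2l h addKn. Qed.

Lemma does_reduction m w G : is_input m ->
  (forall z, z < nbits -> bit z = nth false w z) ->
  exists m' w', does c_reduction G m w m' w' 400 /\
    forall z, z < nout -> m' z = cell z.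
Proof.
move=> hm hbit.
(* [M1 j], [M2 j] and [M3 j] are the memories after [j] rounds of the three loops, and [W1 j] the
   coins left after [j] flips. *)
pose M1 j := updates m tbase j (fun z => nat_of_bool (nth false w z)).
pose W1 j := drop j w.
pose M2 j := updates (M1 nbits) obase j cell.
pose M3 j := updates (M2 nout) 0 j cell.
have in1 j : is_input (M1 j) by apply: is_input_below hm _ => z hz; exact: updates_below.
have in2 j : is_input (M2 j).
  by apply: is_input_below (in1 nbits) _ => z hz; apply: updates_below; exact: ltn_addr.
have rd2 j : is_random (M2 j).
  move=> z hz; rewrite /M2 updates_below; last by rewrite ltn_add2l.
  by rewrite /M1 updates_in // hbit.
exists (M3 nout), (W1 nbits); split; last first.
  by move=> z hz; have := updates_in (M2 nout) 0 cell hz; rewrite add0n.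
have d1 : does (cfor c_nbits (fun z => cflip (cadd c_tbase z))) G m w
    (M1 nbits) (W1 nbits) 82.
  have -> : m = M1 0 by rewrite /M1 updates0.
  have -> : w = W1 0 by rewrite /W1 drop0.
  apply: (does_for (en := 80) (eb := 62)); [exact: bitsB|exact: evals_nbits|].
  move=> j G' cj hj hG hcj.
  have -> : M1 j.+1 = [eta M1 j with tbase + j |-> nat_of_bool (head false (W1 j))].
    by rewrite /M1 updatesS /W1 -nth0 nth_drop addn0.
  have -> : W1 j.+1 = behead (W1 j) by rewrite /W1 -drop1 drop_drop.
  apply: does_flip; apply: (evals_add (e1 := 60) (e2 := 1)); last exact: hcj.
  exact: evals_tbase.
have d2 : does (cfor c_nout (fun z => cwrite (cadd c_obase z) (c_cell z))) G
    (M1 nbits) (W1 nbits) (M2 nout) (W1 nbits) 353.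
  have -> : M1 nbits = M2 0 by rewrite /M2 updates0.
  apply: (does_for (W := fun _ => W1 nbits) (en := 90) (eb := 351));
    [exact: outB|exact: evals_nout|move=> j G' cj hj hG hcj].
  rewrite /M2 updatesS -/(M2 j).
  apply: (does_write _ (e1 := 82) (e2 := 350)); last exact: evals_cell.
  by apply: (evals_add (e1 := 81) (e2 := 1)); [exact: evals_obase|exact: hcj].
apply: (does_seq (e1 := 82) (e2 := 399) d1).
apply: (does_seq (e1 := 353) (e2 := 398) d2).
apply: (does_let (v := obase) (e1 := 81) (e2 := 397)); first exact: evals_obase.
move=> G' o hG ho.
rewrite -{1}(updates0 (M2 nout) 0 cell) -/(M3 0).
apply: (does_for (W := fun _ => W1 nbits) (en := 395) (eb := 395));
  [exact: outB| |move=> j G2 cj hj hG2 hcj].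
  by refine (evals_le _ (evals_nout _)); last by rewrite /M3 updates0.
have -> : M3 j.+1 = [eta M3 j with j |-> M3 j (obase + j)].
  rewrite /M3 updatesS; congr [eta _ with _ |-> _].
  (* Before round [j] only cells below [j] have been overwritten, so copying upwards reads each
     draft cell while it is still intact. *)
  have hlt : (obase + j < 0 + j) = false by lia.
  rewrite {1}/updates hlt andbF.
  by rewrite /M2 updates_in.
apply: (does_write _ (e1 := 1) (e2 := 394)); first exact: hcj.
refine (evals_le _ (evals_read (evals_add (evals_extends hG2 (ho _)) (hcj _)))).
by [].
Qed.

End Program.

End Machine.

(** * Shattering *)

Section Combinatorics.
Local Open Scope nat_scope.

Fixpoint undigits (base n : nat) (f : nat -> nat) : nat :=
  if n is n'.+1 then f 0 + base * undigits base n' (fun i => f i.+1) else 0.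

Lemma undigits_lt base n f :
  (forall i, i < n -> f i < base) -> undigits base n f < base ^ n.
Proof.
elim: n f => [|n IH] f hf //=.
have h0 := hf 0 isT; have h1 := IH (fun i => f i.+1) (fun i hi => hf i.+1 hi).
rewrite expnS; apply: (@leq_trans (base * (undigits base n (fun i => f i.+1)).+1)).
  by rewrite mulnS ltn_add2r.
by rewrite leq_mul2l h1 orbT.
Qed.

Lemma digit_undigits base n f i : (forall j, j < n -> f j < base) -> i < n ->
  digit base (undigits base n f) i = f i.
Proof.
elim: n f i => [|n IH] f [|i] hf //= hi; have h0 := hf 0 isT.
  by rewrite /digit expn0 divn1 addnC (mulnC base) modnMDl modn_small.
have b0 : 0 < base by exact: leq_ltn_trans h0.
rewrite /digit expnS divnMA addnC (mulnC base (undigits _ _ _)) divnMDl // (divn_small h0).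
by rewrite addn0 -/(digit _ _ _) IH // => j hj; exact: hf.
Qed.

Definition class_of (g N : nat) (mem : nat -> nat -> bool) : {set {set 'I_g}} :=
  [set [set x : 'I_g | mem j x] | j : 'I_N].

Variables md a b s E : nat.
Variables (ea eb : nat -> nat) (tab : nat -> nat -> nat) (bit : nat -> nat).

Notation nb := (nblocks a b).
Notation q := (bsize a b).
Notation k := (ntest md a b).
Notation ns := (nassign a b s).
Notation nl := (nlists a b).
Notation g := (gsize a b s).
Notation nc := (nconcepts md a b s).
Notation tst := (test md a b bit).
Notation chk := (checks md a b s E ea eb tab bit).
Notation mem := (member md a b s E ea eb tab bit).

Lemma slot_elt i t : i < nb -> t < ns ->
  [/\ nb + (i * ns + t) < g, (nb + (i * ns + t) - nb) %/ ns = i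
    & (nb + (i * ns + t) - nb) %% ns = t].
Proof.
move=> hi ht; rewrite addKn divnMDl ?(leq_trans _ ht) // divn_small // addn0.
rewrite modnMDl modn_small //; split=> //.
rewrite /gsize ltn_add2l (mulnC ns); apply: (@leq_trans (i.+1 * ns)).
  by rewrite mulSn addnC ltn_add2r.
by rewrite leq_mul2r hi orbT.
Qed.

Lemma checksP H d i t : reflect
  (forall u e j, u < q -> e < E -> j < k ->
     ea e = (i * q + u) %% a -> eb e = tst H j ->
     tab e (digit s t u) = digit s d (nb + j)) (chk H d i t).
Proof.
apply: (iffP allP) => [h u e j hu he hj h1 h2|h u].
  have in_iota n x : x < n -> x \in iota 0 n by rewrite mem_iota.
  have /allP hE := h u (in_iota _ _ hu); have /allP hK := hE e (in_iota _ _ he).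
  by have := hK j (in_iota _ _ hj); rewrite h1 h2 !eqxx => /eqP.
rewrite mem_iota add0n => hu; apply/allP => e; rewrite mem_iota add0n => he.
apply/allP => j; rewrite mem_iota add0n => hj; apply/implyP => /andP[/eqP h1 /eqP h2].
by apply/eqP; exact: h.
Qed.

Lemma memberE c x : mem c x =
  if x < nb then 0 < digit 2 (c %% nl) x else
  (0 < digit s (c %/ nl) ((x - nb) %/ ns)) &&
    chk (c %% nl) (c %/ nl) ((x - nb) %/ ns) ((x - nb) %% ns).
Proof. by []. Qed.

(** The shattered set consists of the [nb] selectors and, for each block, the pair with the
    restriction of the satisfying assignment. For a subset [T], its selectors spell the list [H] and
    its pairs spell the set I; storing the labels [fb] of the tested vertices makes all checks
    succeed. *)
Lemma completeness_VC (fa fb : nat -> nat) : 1 < s ->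
  (forall v, fa v < s) -> (forall v, fb v < s) ->
  (forall e, e < E -> tab e (fa (ea e)) = fb (eb e)) ->
  nb + nb <= VC (class_of g nc mem).
Proof.
move=> s1 hfa hfb sat.
have g0 i : i < nb -> i < g by move=> hi; apply: leq_trans hi _; exact: leq_addr.
have ns0 : 0 < ns by rewrite expn_gt0 (ltnW s1).
pose code i := undigits s q (fun u => fa ((i * q + u) %% a)).
have codelt i : code i < ns by exact: undigits_lt.
have eltlt (i : 'I_nb) : nb + (i * ns + code i) < g.
  by have [] := slot_elt (ltn_ord i) (codelt i).
pose elt (z : 'I_nb + 'I_nb) : 'I_g := match z with
  | inl i => Ordinal (g0 i (ltn_ord i)) | inr i => Ordinal (eltlt i) end.
have elt_inj : injective elt.
  case=> [[i hi]|i] [[j hj]|j] //.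
  - by move=> /(congr1 val) /= eij; congr inl; apply: val_inj.
  - by move=> /(congr1 val) /= eij; exfalso; have := hi; rewrite eij ltnNge leq_addr.
  - by move=> /(congr1 val) /= eij; exfalso; have := hj; rewrite -eij ltnNge leq_addr.
  move=> /(congr1 val) /= eij; congr inr; apply: val_inj => /=.
  have [_ <- _] := slot_elt (ltn_ord i) (codelt i).
  by rewrite eij; have [_ -> _] := slot_elt (ltn_ord j) (codelt j).
pose S := [set elt z | z : 'I_nb + 'I_nb].
have cS : #|S| = nb + nb by rewrite card_imset // card_sum !card_ord.
rewrite -cS /VC; apply: (@leq_bigmax_cond _ (shattered _) (fun S => #|S|)).
apply/forallP => T; apply/implyP => TS.
pose H := undigits 2 nb (fun i =>
  if insub i is Some i' then nat_of_bool (elt (inl i') \in T) else 0).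
have dH (i : 'I_nb) : digit 2 H i = (elt (inl i) \in T).
  rewrite digit_undigits ?valK //= => j hj.
  by case: insub => // i'; case: (_ \in _).
have Hlt : H < nl.
  by apply: undigits_lt => j hj; case: insub => // i'; case: (_ \in _).
(* The digits 0 and 1 both occur as membership marks, which is where [1 < s] enters. *)
pose f i := if insub i is Some i' then nat_of_bool (elt (inr i') \in T)
            else fb (tst H (i - nb)).
have flt i : f i < s by rewrite /f; case: insub => // i'; case: (_ \in _); lia.
pose d := undigits s (nb + k) f.
have d1 (i : 'I_nb) : digit s d i = (elt (inr i) \in T).
  by rewrite digit_undigits ?ltn_addr // /f valK.
have d2 j : j < k -> digit s d (nb + j) = fb (tst H j).
  move=> hj; rewrite digit_undigits ?ltn_add2l // /f insubF ?addKn //.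
  by rewrite ltnNge leq_addr.
have clt : d * nl + H < nc.
  have hd : d < ndigits md a b s by exact: undigits_lt.
  apply: (@leq_trans (d.+1 * nl)); first by rewrite mulSn addnC ltn_add2r.
  by rewrite /nconcepts leq_mul2r hd orbT.
have nl0 : 0 < nl by exact: leq_ltn_trans Hlt.
apply/existsP; exists [set x : 'I_g | mem (d * nl + H) x]; apply/andP; split.
  by apply/imsetP; exists (Ordinal clt).
have key z : (elt z \in T) = mem (d * nl + H) (elt z).
  rewrite memberE divnMDl // divn_small // addn0 modnMDl modn_small //.
  case: z => i.
    by rewrite [X in if X then _ else _](ltn_ord i) dH; case: (_ \in _).
  rewrite [X in if X then _ else _]ltnNge leq_addr [val (elt (inr i))]/=.
  have [_ -> ->] := slot_elt (ltn_ord i) (codelt i).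
  rewrite d1; have -> : chk H d i (code i).
    apply/checksP => u e j hu he hj e1 e2.
    by rewrite digit_undigits // -e1 sat // d2 // e2.
  by rewrite andbT; case: (_ \in _).
apply/eqP/setP => x; rewrite !inE; apply/idP/andP => [xT|[]].
  have xS := subsetP TS x xT; split=> //.
  by case/imsetP: xS xT => z _ ->; rewrite key.
by case/imsetP => z _ ->; rewrite key.
Qed.

(** [None] stands for a block that the shattered set does not meet. *)
Definition choice_of := {ffun 'I_nb -> option 'I_ns}.

Definition chosen (rep : choice_of) : {set 'I_nb} := [set i | rep i != None].

(** A concept containing all chosen elements stores such a common label for each vertex it tests. A
    value [v] reached by no edge from a chosen block is consistent with any label. *)
Definition consistent (rep : choice_of) (v : nat) : bool :=
  [exists lbl : 'I_s, [forall i, if rep i is Some t then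
     all (fun u => all (fun e =>
        (ea e == (i * q + u) %% a) && (eb e == v)
          ==> (tab e (digit s t u) == lbl)) (iota 0 E)) (iota 0 q) else true]].

Definition passes (rep : choice_of) (H : nat) : bool :=
  all (fun j => consistent rep (tst H j)) (iota 0 k).

Lemma consistentP (rep : choice_of) v : reflect
  (exists2 lbl, lbl < s & forall (i : 'I_nb) t u e, rep i = Some t -> u < q -> e < E ->
     ea e = (i * q + u) %% a -> eb e = v -> tab e (digit s t u) = lbl)
  (consistent rep v).
Proof.
apply: (iffP existsP) => [[lbl /forallP h]|[lbl hlt h]].
  exists (val lbl); [exact: ltn_ord|move=> i t u e ri hu he e1 e2]; have := h i; rewrite ri.
  have in_iota n x : x < n -> x \in iota 0 n by rewrite mem_iota.
  move=> /allP hQ; have /allP hE := hQ u (in_iota _ _ hu).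
  by have := hE e (in_iota _ _ he); rewrite e1 e2 !eqxx => /eqP.
exists (Ordinal hlt); apply/forallP => i; case ri : (rep i) => [t|] //.
apply/allP => u; rewrite mem_iota add0n => hu; apply/allP => e.
rewrite mem_iota add0n => he; apply/implyP => /andP[/eqP e1 /eqP e2].
by apply/eqP; exact: h ri _ _ _ _.
Qed.

(* For a shattered [W], fix one element of [W] in each block that meets [W].
   The traces on [W] containing all of them are determined by the list of tests
   of the concept, and every such list is passed by the chosen assignments. *)
Lemma shattered_passes (W : {set 'I_g}) : 0 < s ->
  shattered (class_of g nc mem) W ->
  exists rep : choice_of,
    2 ^ (#|W| - #|chosen rep|) <= #|[set H : 'I_nl | passes rep H]|.
Proof.
move=> s0 shW.
have ns0 : 0 < ns by rewrite expn_gt0 s0.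
have nl0 : 0 < nl by rewrite expn_gt0.
have blk_lt (x : 'I_g) : nb <= x -> (x - nb) %/ ns < nb.
  move=> hx; rewrite ltn_divLR // mulnC; have hx' : x < nb + ns * nb := ltn_ord x.
  lia.
pose inblk (i : 'I_nb) (x : 'I_g) := (nb <= x) && ((x - nb) %/ ns == i).
pose rp i := [pick x in W | inblk i x].
pose tau (x : 'I_g) : 'I_ns := Ordinal (ltn_pmod (x - nb) ns0).
pose rep : choice_of := [ffun i => omap tau (rp i)].
pose R := [set x in W | [exists i, rp i == Some x]].
have RW : R \subset W by apply/subsetP => x; rewrite inE => /andP[].
have cR : #|R| <= #|chosen rep|.
  have hR x : x \in R -> exists i, rp i = Some x.
    by rewrite inE => /andP[_ /existsP[i /eqP hi]]; exists i.
  have sub2 : [set Some x | x in R] \subset [set rp i | i in chosen rep].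
    apply/subsetP => _ /imsetP[x /hR[i hi] ->]; apply/imsetP; exists i => //.
    by rewrite inE ffunE hi.
  rewrite -(card_imset R (@Some_inj _)); apply: leq_trans (subset_leq_card sub2) _.
  exact: leq_imset_card.
pose Z := W :\: R.
have cZ : #|W| - #|chosen rep| <= #|Z|.
  by rewrite cardsD (setIidPr RW) leq_sub2l.
(* Outside the subsets of [Z] an arbitrary concept is returned, so that the choice of concepts
   becomes a total function. *)
have hT (T : {set 'I_g}) : exists c : 'I_nc, T \subset Z -> 
    forall x, x \in W -> mem c x = (x \in T) || (x \in R).
  have [TZ|nTZ] := boolP (T \subset Z); last first.
    have nc0 : 0 < nc by rewrite muln_gt0 !expn_gt0 s0.
    by exists (Ordinal nc0).
  have /forallP/(_ (T :|: R))/implyP hs := shW.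
  have /hs /existsP[D /andP[/imsetP[c _ ->] /eqP eD]] : T :|: R \subset W.
    by rewrite subUset RW andbT; apply: subset_trans TZ _; exact: subsetDl.
  exists c => _ x xW; move/setP/(_ x): eD; rewrite !inE xW /= => <- //.
have [cc hcc] := fin_all_exists hT.
pose HH T : 'I_nl := Ordinal (ltn_pmod (cc T) nl0).
have repR x : x \in W -> nb <= x -> exists2 r : 'I_g, r \in R &
    [/\ nb <= r, (r - nb) %/ ns = (x - nb) %/ ns &
        forall i : 'I_nb, i = (x - nb) %/ ns :> nat -> rep i = Some (tau r)].
  move=> xW hx; pose i := Ordinal (blk_lt x hx).
  have : rp i != None.
    by rewrite /rp; case: pickP => // /(_ x); rewrite xW /inblk hx eqxx.
  case ri : (rp i) => [r|] // _.
  have : (r \in W) && inblk i r by move: ri; rewrite /rp; case: pickP => // y hy [<-].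
  case/andP => rW /andP[hr /eqP er]; exists r.
    by rewrite inE rW; apply/existsP; exists i; rewrite ri.
  split=> // i' ei'; have -> : i' = i by exact: val_inj.
  by rewrite ffunE ri.
have inR (T : {set 'I_g}) x : T \subset Z -> x \in R -> mem (cc T) x.
  by move=> TZ xR; rewrite (hcc T TZ) ?xR ?orbT // (subsetP RW).
have repx i t : rep i = Some t -> exists2 r : 'I_g, r \in R &
    [/\ nb <= r, (r - nb) %/ ns = i & (r - nb) %% ns = t].
  rewrite ffunE; case ri : (rp i) => [r|] //= [<-].
  have : (r \in W) && inblk i r by move: ri; rewrite /rp; case: pickP => // y hy [<-].
  case/andP => rW /andP[hr /eqP er]; exists r; last by [].
  by rewrite inE rW; apply/existsP; exists i; rewrite ri.
(* The concept of [T] contains all representatives, so the label it stores for the [j]-th test is a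
   common label for them. *)
have passHH (T : {set 'I_g}) : T \subset Z -> passes rep (HH T).
  move=> TZ; apply/allP => j; rewrite mem_iota add0n => hj; apply/consistentP.
  exists (digit s (cc T %/ nl) (nb + j)); first by rewrite ltn_mod.
  move=> i t u e /repx[r rR [hr er et]] hu he e1 e2.
  have := inR T r TZ rR; rewrite memberE ltnNge hr /= er et => /andP[_ /checksP].
  by apply.
(* Let two concepts share the list. Any [x] of [W] in a block has a representative [r] there that
   lies in both concepts, so both activate the block, and their labels agree, via [r], at every test
   with an edge from the block. The checks on [x] therefore have the same outcome. *)
have injHH : {in powerset Z &, injective HH}.
  move=> T1 T2; rewrite !inE => TZ1 TZ2 /(congr1 val) /= eH.
  suff eqm x : x \in W -> mem (cc T1) x = mem (cc T2) x.
    apply/setP => x; have [xZ|xZ] := boolP (x \in Z); last first.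
      by rewrite (contraNF (subsetP TZ1 x) xZ) (contraNF (subsetP TZ2 x) xZ).
    move: xZ; rewrite inE => /andP[/negbTE xR xW]; have := eqm x xW.
    by rewrite !hcc // xR !orbF.
  move=> xW; rewrite !memberE eH; case: ltnP => // hx.
  have [r rR [hr er hrep]] := repR x xW hx.
  have h1 := inR T1 r TZ1 rR; have h2 := inR T2 r TZ2 rR.
  move: h1 h2; rewrite !memberE !eH !ltnNge hr /= er => /andP[-> /checksP c1].
  case/andP => -> /checksP c2 /=.
  apply/checksP/checksP => h u e j hu he hj e1 e2; rewrite (h u e j) //.
    by rewrite -(c1 u e j) // (c2 u e j).
  by rewrite -(c2 u e j) // (c1 u e j).
exists rep; apply: (@leq_trans (2 ^ #|Z|)); first by rewrite leq_exp2l.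
rewrite -card_powerset -(card_in_imset injHH); apply: subset_leq_card.
apply/subsetP => _ /imsetP[T TZ ->]; rewrite inE; apply: passHH.
by rewrite powersetE in TZ.
Qed.

End Combinatorics.

(** * Counting in a bi-regular instance *)

Section LabelCoverCounting.
Local Open Scope nat_scope.

Lemma card_edges_inA (A B Sigma : finType) (L : label_cover A B Sigma) d (X : {set A}) :
  (forall v, degA L v = d) -> #|[set p in edges L | p.1 \in X]| = #|X| * d.
Proof.
move=> hd; rewrite -sum1_card (partition_big fst (mem X)) /=; last first.
  by move=> p; rewrite inE => /andP[].
rewrite -sum_nat_const; apply: eq_bigr => v vX; rewrite -(hd v) sum1_card /degA.
have pinj : injective (fun y : B => (v, y)) by move=> y y' [].
rewrite -(card_imset _ pinj); apply: eq_card => -[x y].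
rewrite [LHS]unfold_in /= inE /=; apply/idP/imsetP => [|[z]].
  by case/andP=> /andP[pE _] /eqP xv; exists y; rewrite ?inE -?xv.
by rewrite inE => vz [-> ->]; rewrite vz eqxx vX.
Qed.

Lemma card_edges_inB (A B Sigma : finType) (L : label_cover A B Sigma) d (Y : {set B}) :
  (forall v, degB L v = d) -> #|[set p in edges L | p.2 \in Y]| = #|Y| * d.
Proof.
move=> hd; rewrite -sum1_card (partition_big snd (mem Y)) /=; last first.
  by move=> p; rewrite inE => /andP[].
rewrite -sum_nat_const; apply: eq_bigr => v vY; rewrite -(hd v) sum1_card /degB.
have pinj : injective (fun x : A => (x, v)) by move=> x x' [].
rewrite -(card_imset _ pinj); apply: eq_card => -[x y].
rewrite [LHS]unfold_in /= inE /=; apply/idP/imsetP => [|[z]].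
  by case/andP=> /andP[pE _] /eqP yv; exists x; rewrite ?inE -?yv.
by rewrite inE => vz [-> ->]; rewrite vz eqxx vY.
Qed.

Variables (a b s : nat) (L : label_cover 'I_a 'I_b 'I_s).

Definition edge_a (e : nat) : nat :=
  nth 0 [seq nat_of_ord p.1 | p <- enum (edges L)] e.
Definition edge_b (e : nat) : nat :=
  nth 0 [seq nat_of_ord p.2 | p <- enum (edges L)] e.
Definition edge_tab (e x : nat) : nat :=
  nth 0 (nth [::] [seq [seq nat_of_ord (proj L p y) | y <- enum 'I_s]
                  | p <- enum (edges L)] e) x.

Lemma edge_nth p0 e : e < #|edges L| -> let p := nth p0 (enum (edges L)) e in
  [/\ p \in edges L, edge_a e = p.1, edge_b e = p.2
    & forall x : 'I_s, edge_tab e x = proj L p x].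
Proof.
rewrite cardE => he p; split=> [|||x].
- by rewrite -mem_enum mem_nth.
- by rewrite /edge_a (nth_map p0).
- by rewrite /edge_b (nth_map p0).
- by rewrite /edge_tab (nth_map p0) // (nth_map x) ?size_enum_ord ?nth_ord_enum.
Qed.

Lemma edge_index p : p \in edges L -> let e := index p (enum (edges L)) in
  [/\ e < #|edges L|, edge_a e = p.1, edge_b e = p.2
    & forall x : 'I_s, edge_tab e x = proj L p x].
Proof.
move=> pE e; have he : e < #|edges L| by rewrite cardE index_mem mem_enum.
have [_ h1 h2 h3] := edge_nth p he.
by move: h1 h2 h3; rewrite /e nth_index ?mem_enum.
Qed.

Notation nb := (nblocks a b).
Notation q := (bsize a b).
Notation ns := (nassign a b s).
Notation E := #|edges L|.

Variable rep : choice_of a b s.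
Notation cons := (consistent E edge_a edge_b edge_tab rep).

Definition reached : {set 'I_a} :=
  [set v : 'I_a | [exists i : 'I_nb, [exists u : 'I_q,
     (rep i != None) && ((i * q + u) %% a == v)]]].

(** The slots run through 0, ..., [nb * q - 1] and are reduced modulo [a], so each vertex fills at
    most [c = (nb * q) %/ a + 1] of them. As [a <= nb * q], [c * a] is at most twice the number of
    slots; this is the factor 2. *)
Lemma card_reached : 0 < a -> a <= nb * q -> #|chosen rep| * a <= 2 * nb * #|reached|.
Proof.
move=> a0 hq; have q0 : 0 < q by case: (q) hq => //; rewrite muln0 leqNgt a0.
pose c := (nb * q) %/ a + 1.
have lt_slot (i : 'I_nb) (u : 'I_q) : i * q + u < nb * q.
  apply: (@leq_trans (i.+1 * q)); first by rewrite mulSn addnC ltn_add2r.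
  by rewrite leq_mul2r ltn_ord orbT.
have lt_c (z : 'I_nb * 'I_q) : (z.1 * q + z.2) %/ a < c.
  by rewrite /c addn1 ltnS leq_div2r // ltnW.
pose f (z : 'I_nb * 'I_q) : 'I_a * 'I_c :=
  (Ordinal (ltn_pmod (z.1 * q + z.2) a0), Ordinal (lt_c z)).
have finj : injective f.
  move=> [i u] [j v] [e1 e2].
  have e : i * q + u = j * q + v.
    by rewrite (divn_eq (i * q + u) a) e1 e2 -divn_eq.
  have eij : i = j :> nat.
    by have := congr1 (divn^~ q) e; rewrite !divnMDl // !divn_small // !addn0.
  congr (_, _); apply: val_inj => //=.
  by have := congr1 (modn^~ q) e; rewrite !modnMDl !modn_small.
have h : #|chosen rep| * q <= #|reached| * c.
  have -> : #|chosen rep| * q = #|setX (chosen rep) [set: 'I_q]|.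
    by rewrite cardsX cardsT card_ord.
  have -> : #|reached| * c = #|setX reached [set: 'I_c]|.
    by rewrite cardsX cardsT card_ord.
  rewrite -(card_imset _ finj); apply: subset_leq_card; apply/subsetP => _ /imsetP[[i u] hi ->].
  move: hi; rewrite !inE /= !andbT => hi; apply/existsP; exists i.
  by apply/existsP; exists u; rewrite hi /=.
have hc : c * a <= 2 * (nb * q).
  by rewrite /c mulnDl mul1n; have := leq_trunc_div (nb * q) a; lia.
rewrite -(leq_pmul2r q0); apply: (@leq_trans (#|reached| * c * a)).
  by rewrite mulnAC leq_mul2r h orbT.
rewrite -mulnA; apply: (@leq_trans (#|reached| * (2 * (nb * q)))).
  by rewrite leq_mul2l hc orbT.
by lia.
Qed.

(* Extend the chosen assignments to [B] by the common label wherever they are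
   consistent; this satisfies all edges between [reached] and consistent
   vertices. *)
Lemma inconsistent_many (dA dB : nat) : 0 < a -> 0 < s ->
  (forall v, degA L v = dA) -> (forall v, degB L v = dB) ->
  #|reached| * dA <= \max_(phi : {ffun 'I_a + 'I_b -> 'I_s}) #|satisfied L phi|
     + #|[set v : 'I_b | ~~ cons v]| * dB.
Proof.
move=> a0 s0 hA hB.
(* A vertex may fill several slots of chosen blocks, with different labels. Any of them will do,
   because consistency at a neighbour speaks of all of them. *)
pose slot (v : 'I_a) := [pick z : 'I_nb * 'I_q | (rep z.1 != None) &&
   ((z.1 * q + z.2) %% a == v)].
pose phiA v : 'I_s := if slot v is Some z then
   if rep z.1 is Some t then Ordinal (ltn_pmod (t %/ s ^ z.2) s0) else Ordinal s0
  else Ordinal s0.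
have hphiA v : v \in reached -> exists (i : 'I_nb) (u : 'I_q) (t : 'I_ns),
    [/\ rep i = Some t, (i * q + u) %% a = v & phiA v = digit s t u :> nat].
  rewrite inE => /existsP[i /existsP[u hiu]]; rewrite /phiA /slot.
  case: pickP => [[j w] /= /andP[hj /eqP ej]|/(_ (i, u))]; last by rewrite hiu.
  by case rj : (rep j) hj => [t|] // _; exists j, w, t.
pose phiB (v : 'I_b) : 'I_s := if [pick lbl : 'I_s | [forall i, forall u : 'I_q,
     forall e : 'I_E, if rep i is Some t then ((edge_a e == (i * q + u) %% a) &&
       (edge_b e == v)) ==> (edge_tab e (digit s t u) == lbl) else true]] is Some lbl
   then lbl else Ordinal s0.
have hphiB (v : 'I_b) (i : 'I_nb) t (u : 'I_q) e : cons v -> rep i = Some t ->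
    e < E -> edge_a e = (i * q + u) %% a -> edge_b e = v ->
    edge_tab e (digit s t u) = phiB v.
  move=> /consistentP[lbl hl hlbl] ri he e1 e2; rewrite /phiB.
  case: pickP => [l /forallP/(_ i)/forallP/(_ u)/forallP/(_ (Ordinal he))|].
    by rewrite ri /= e1 e2 !eqxx => /eqP.
  move=> /(_ (Ordinal hl))/negP[]; apply/forallP => i'; apply/forallP => u'.
  apply/forallP => e'; case ri' : (rep i') => [t'|] //.
  by apply/implyP => /andP[/eqP h1 /eqP h2]; rewrite (hlbl i' t' u' e').
pose phi : {ffun 'I_a + 'I_b -> 'I_s} :=
  [ffun z => match z with inl v => phiA v | inr v => phiB v end].
pose I := [set v : 'I_b | ~~ cons v].
rewrite -(card_edges_inA _ hA) -/I -(card_edges_inB I hB).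
apply: (@leq_trans (#|satisfied L phi| + #|[set p in edges L | p.2 \in I]|)).
  apply: leq_trans (leq_card_setU _ _); apply: subset_leq_card.
  apply/subsetP => p; rewrite inE => /andP[pE pR]; rewrite !inE pE /=.
  case: (boolP (cons p.2)) => [hc|]; last by rewrite orbT.
  rewrite orbF !ffunE; have [i [u [t [ri ei et]]]] := hphiA _ pR.
  have [he h1 h2 h3] := edge_index pE.
  apply/eqP; apply: val_inj; rewrite /= -(hphiB _ _ _ u _ hc ri he) //.
    by rewrite -h3 et.
  by rewrite h1 ei.
by rewrite leq_add2r; exact: (leq_bigmax phi).
Qed.

End LabelCoverCounting.

(** * The random tests *)

Section Tests.
Local Open Scope nat_scope.

Lemma bernoulli_expn n j : n ^ j.+1 + j.+1 * n ^ j <= n.+1 ^ j.+1.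
Proof.
elim: j => [|j IH]; first by rewrite !expn1 expn0 muln1 addn1.
rewrite [n.+1 ^ _]expnS; apply: leq_trans (leq_mul (leqnn n.+1) IH).
rewrite !expnS; lia.
Qed.

(** This is (1 - 1/m)^m <= 1/2 cleared of denominators; it follows from the first two terms of the
    binomial expansion. *)
Lemma half_expn m x y : 0 < m -> m * x <= m.-1 * y -> x ^ m * 2 <= y ^ m.
Proof.
case: m => // n _ h; rewrite -(@leq_pmul2l (n.+1 ^ n.+1)) ?expn_gt0 //.
rewrite mulnA -expnMn; apply: (@leq_trans ((n * y) ^ n.+1 * 2)).
  by rewrite leq_mul2r leq_exp2r.
rewrite expnMn mulnAC leq_mul2r; apply/orP; right.
by apply: leq_trans (bernoulli_expn n n); rewrite !expnS; lia.
Qed.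

(** Independence in counting form: injectivity of [idx] makes the groups of [l] coins disjoint, so
    the probability that every group lies in [X] is at most (#|X| / 2^l)^#|P|. A coin sequence is
    determined by its groups and the coins outside them. *)
Lemma card_cylinder (P : finType) (l T : nat) (idx : P * 'I_l -> 'I_T)
    (X : {set {ffun 'I_l -> bool}}) : injective idx ->
  #|[set w : T.-tuple bool | [forall p, [ffun i => tnth w (idx (p, i))] \in X]]|
    * (2 ^ l) ^ #|P| <= #|X| ^ #|P| * 2 ^ T.
Proof.
move=> idx_inj; set W := [set w | _].
pose rest := {z : 'I_T | z \notin codom idx}.
have crest : #|{: rest}| + l * #|P| = T.
  rewrite card_sig -[RHS]card_ord -(cardC (mem (codom idx))) addnC.
  congr (_ + _); first by rewrite (card_codom idx_inj) card_prod card_ord mulnC.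
pose F (w : T.-tuple bool) : {ffun P -> {ffun 'I_l -> bool}} * {ffun rest -> bool} :=
  ([ffun p => [ffun i => tnth w (idx (p, i))]], [ffun z => tnth w (val z)]).
have F_inj : injective F.
  move=> w1 w2 [/ffunP e1 /ffunP e2]; apply: eq_from_tnth => z.
  have [/codomP[[p i] ->]|hz] := boolP (z \in codom idx).
    by have /ffunP/(_ i) := e1 p; rewrite !ffunE.
  by have := e2 (Sub z hz); rewrite !ffunE.
have cW : #|W| <= #|X| ^ #|P| * 2 ^ #|{: rest}|.
  rewrite -(card_imset _ F_inj).
  have -> : #|X| ^ #|P| * 2 ^ #|{: rest}| =
      #|setX [set f : {ffun P -> {ffun 'I_l -> bool}} | f \in ffun_on (mem X)]
          [set: {ffun rest -> bool}]|.
    by rewrite cardsX cardsT card_ffun card_bool cardsE card_ffun_on.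
  apply: subset_leq_card; apply/subsetP => _ /imsetP[w hw ->].
  rewrite !inE andbT; apply/ffun_onP => p; rewrite ffunE.
  by move: hw; rewrite inE => /forallP/(_ p).
apply: (@leq_trans (#|X| ^ #|P| * 2 ^ #|{: rest}| * (2 ^ l) ^ #|P|)).
  by rewrite leq_mul2r cW orbT.
by rewrite -mulnA -expnM -expnD crest.
Qed.

(** The recursion of [test] for an arbitrary bit stream, so that a test becomes a function of one
    string of coins. *)
Definition horner (l : nat) (f : nat -> nat) : nat :=
  iteri l (fun i acc => acc + acc + f i) 0.

Lemma eq_horner l f f' : (forall i, i < l -> f i = f' i) -> horner l f = horner l f'.
Proof.
rewrite /horner; elim: l => //= l IH h; rewrite h // IH // => i hi.
by apply: h; exact: ltnW.
Qed.

Lemma horner_surj l v : v < 2 ^ l -> exists f : nat -> bool, horner l f = v.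
Proof.
elim: l v => [|l IH] v hv; first by exists (fun=> false); case: v hv.
have [|f hf] := IH v./2; first by rewrite ltn_half_double -muln2 -expnSr.
exists (fun i => if i < l then f i else odd v).
rewrite /horner /= -/(horner _ _) (_ : horner l _ = horner l f) ?hf.
  by rewrite ltnn addnn addnC odd_double_half.
by rewrite -hf; apply: eq_horner => i ->.
Qed.

Variables (md a b s E : nat) (ea eb : nat -> nat) (tab : nat -> nat -> nat).
Notation nb := (nblocks a b).
Notation k := (ntest md a b).
Notation l := (lbits b).
Notation ns := (nassign a b s).
Notation nl := (nlists a b).
Notation cons := (consistent E ea eb tab).

Definition total_bit (f : {ffun 'I_l -> bool}) (i : nat) : bool :=
  if insub i is Some i' then f i' else false.

Definition good (rep : choice_of a b s) : {set {ffun 'I_l -> bool}} :=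
  [set f | cons rep (horner l (total_bit f))].

(** Distinct inconsistent vertices are the values of distinct strings outside [good]. Strings of
    value [b] or more contribute no failures to this count, which is why [lbits_le] is invoked
    later. *)
Lemma card_good rep : b <= 2 ^ l ->
  #|good rep| + #|[set v : 'I_b | ~~ cons rep v]| <= 2 ^ l.
Proof.
move=> hb; set I := [set v | _].
have hex (v : 'I_b) : exists f : {ffun 'I_l -> bool}, horner l (total_bit f) = v.
  have [|g hg] := @horner_surj l v.
    exact: leq_trans hb.
  exists [ffun i : 'I_l => g i]; rewrite -[RHS]hg; apply: eq_horner => i hi.
  by rewrite /total_bit insubT ffunE.
have [f hf] := fin_all_exists hex.
have f_inj : injective f by move=> u v e; apply: val_inj; rewrite /= -hf e hf.
rewrite -(card_imset _ f_inj) -cardsUI (_ : _ :&: _ = set0) ?cards0 ?addn0.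
  by apply: leq_trans (max_card _) _; rewrite card_ffun card_bool card_ord.
apply/setP => g; rewrite !inE; apply/negP => /andP[hg /imsetP[v hv e]].
by move: hg hv; rewrite inE e hf => ->.
Qed.

Definition coin_bit (w : seq bool) (z : nat) : nat := nth false w z.

Definition fooled (T h : nat) (w : T.-tuple bool) : bool :=
  [exists rep : choice_of a b s, (h <= #|chosen rep|) && (2 ^ h <=
    #|[set H : 'I_nl | passes md E ea eb tab (coin_bit w) rep H]|)].

(** Each of the [#|HH| * k] tests reads its own [l] coins, so [card_cylinder] applies. *)
Lemma card_pass (T : nat) (rep : choice_of a b s) (HH : {set 'I_nl}) :
  nbits md a b <= T ->
  #|[set w : T.-tuple bool | [forall H in HH, passes md E ea eb tab (coin_bit w) rep H]]|
    * (2 ^ l) ^ (#|HH| * k) <= #|good rep| ^ (#|HH| * k) * 2 ^ T.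
Proof.
move=> hT.
have lt1 (H : 'I_nl) (j : 'I_k) : H * k + j < nl * k.
  apply: (@leq_trans (H.+1 * k)); first by rewrite mulSn addnC ltn_add2r.
  by rewrite leq_mul2r ltn_ord orbT.
have lt2 (H : 'I_nl) (j : 'I_k) (i : 'I_l) : (H * k + j) * l + i < T.
  apply: leq_trans hT; apply: (@leq_trans ((H * k + j).+1 * l)).
    by rewrite mulSn addnC ltn_add2r.
  by rewrite leq_mul2r lt1 orbT.
pose P := ({H : 'I_nl | H \in HH} * 'I_k)%type.
pose idx (z : P * 'I_l) : 'I_T := Ordinal (lt2 (val z.1.1) z.1.2 z.2).
have idx_inj : injective idx.
  move=> [[H1 j1] i1] [[H2 j2] i2] /(congr1 val) /= e.
  have ei : i1 = i2 :> nat.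
    by have := congr1 (modn^~ l) e; rewrite !modnMDl !modn_small.
  have l0 : 0 < l by exact: leq_ltn_trans (ltn_ord i1).
  have e2 : val H1 * k + j1 = val H2 * k + j2.
    by have := congr1 (divn^~ l) e; rewrite !divnMDl // !divn_small // !addn0.
  have k0 : 0 < k by exact: leq_ltn_trans (ltn_ord j1).
  have ej : j1 = j2 :> nat.
    by have := congr1 (modn^~ k) e2; rewrite !modnMDl !modn_small.
  have eH : val (val H1) = val (val H2).
    by have := congr1 (divn^~ k) e2; rewrite !divnMDl // !divn_small // !addn0.
  by congr (_, _, _); apply: val_inj => //; apply: val_inj.
have cP : #|{: P}| = #|HH| * k by rewrite card_prod card_ord card_sig.
rewrite -cP; apply: leq_trans (card_cylinder (good rep) idx_inj).
rewrite leq_mul2r; apply/orP; right; apply: subset_leq_card; apply/subsetP => w.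
rewrite !inE => /forallP hw; apply/forallP => -[[H HHH] j]; rewrite inE.
have := hw H; rewrite HHH => /= /allP/(_ (val j)); rewrite mem_iota add0n ltn_ord.
move=> /(_ isT); congr (is_true (cons rep _)).
rewrite /test -/(horner l (fun i => coin_bit w ((H * k + j) * l + i))).
apply: eq_horner => i hi; rewrite /total_bit insubT ffunE /coin_bit /= (tnth_nth false) //.
Qed.

Lemma bin_le_expn n m : 'C(n, m) <= n ^ m.
Proof.
apply: (@leq_trans (n ^_ m)).
  by rewrite -bin_ffact leq_pmulr // fact_gt0.
elim: m => [|m IH]; first by rewrite ffactn0.
by rewrite ffactnSr expnSr leq_mul // leq_subr.
Qed.

(** Union bound over the pairs of a choice and a set of exactly [M] lists. There are at most
    [ns.+1 ^ nb * 2 ^ (nb * M)] of them, which reduces the exponent [3 * nb * M] to [2 * nb * M]. *)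
Lemma card_fooled (T h : nat) : nbits md a b <= T -> 0 < md ->
  (forall rep : choice_of a b s, h <= #|chosen rep| ->
     8 * md * #|good rep| <= (8 * md).-1 * 2 ^ l) ->
  #|[set w : T.-tuple bool | fooled h w]| * 2 ^ (2 * nb * 2 ^ h) <=
    ns.+1 ^ nb * 2 ^ T.
Proof.
move=> hT md0 hgood; set M := 2 ^ h.
pose I := (choice_of a b s * {set 'I_nl})%type.
pose A := [set i : I | (h <= #|chosen i.1|) && (#|i.2| == M)].
pose C (i : I) := [set w : T.-tuple bool |
  [forall H in i.2, passes md E ea eb tab (coin_bit w) i.1 H]].
have hC i : i \in A -> #|C i| * 2 ^ (3 * nb * M) <= 2 ^ T.
  rewrite inE => /andP[hi /eqP hM].
  have h1 := card_pass i.1 i.2 hT; rewrite hM -/(C i) in h1.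
  have h2 := half_expn _ (hgood _ hi); rewrite muln_gt0 md0 in h2.
  have {h2} h2 : #|good i.1| ^ (M * k) * 2 ^ (3 * nb * M) <= (2 ^ l) ^ (M * k).
    (* [half_expn] gains one factor 2 for each group of [8 * md] tests. *)
    have -> : M * k = 8 * md * (3 * nb * M) by rewrite /ntest; lia.
    rewrite (expnM #|_|) (expnM (2 ^ l)) -expnMn.
    have [->|n0] := posnP (3 * nb * M); first by rewrite !expn0.
    by rewrite leq_exp2r // h2.
  have p0 : 0 < (2 ^ l) ^ (M * k) by rewrite !expn_gt0.
  rewrite -(leq_pmul2r p0) mulnAC; apply: (@leq_trans
    (#|good i.1| ^ (M * k) * 2 ^ T * 2 ^ (3 * nb * M))).
    by rewrite leq_mul2r h1 orbT.
  by rewrite mulnAC mulnC leq_mul2l h2 orbT.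
have cA : #|A| <= ns.+1 ^ nb * 2 ^ (nb * M).
  apply: (@leq_trans #|setX [set: choice_of a b s] [set B : {set 'I_nl} | #|B| == M]|).
    apply: subset_leq_card; apply/subsetP => -[rep B]; rewrite !inE /=.
    by case/andP => _ ->.
  rewrite cardsX cardsT card_ffun card_option !card_ord card_draws card_ord.
  by rewrite leq_mul2l expnM bin_le_expn orbT.
have cW : #|[set w : T.-tuple bool | fooled h w]| <= \sum_(i in A) #|C i|.
  apply: (@leq_trans #|\bigcup_(i in A) C i|); last first.
    elim/big_rec2: _ => [|i n B _ IH]; first by rewrite cards0.
    by apply: leq_trans (leq_card_setU _ _) _; rewrite leq_add2l.
  apply: subset_leq_card; apply/subsetP => w; rewrite inE => /existsP[rep].
  set Q := [set H | _]; case/andP => hr hQ.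
  have [B BQ cB] : exists2 B : {set 'I_nl}, B \subset Q & #|B| = M.
    exists [set x in take M (enum Q)].
      by apply/subsetP => x; rewrite inE => /mem_take; rewrite mem_enum.
    rewrite cardsE (card_uniqP _) ?size_take -?cardE ?take_uniq ?enum_uniq //.
    by apply/minn_idPl.
  apply/bigcupP; exists (rep, B); first by rewrite inE hr cB eqxx.
  rewrite inE; apply/forallP => H; apply/implyP => /(subsetP BQ).
  by rewrite inE.
have hs : \sum_(i in A) #|C i| * 2 ^ (3 * nb * M) <= #|A| * 2 ^ T.
  by rewrite -sum_nat_const; apply: leq_sum => i; exact: hC.
have p0 : 0 < 2 ^ (nb * M) by rewrite expn_gt0.
rewrite -(leq_pmul2r p0) -mulnA -expnD.
have -> : 2 * nb * M + nb * M = 3 * nb * M by lia.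
apply: (@leq_trans ((\sum_(i in A) #|C i|) * 2 ^ (3 * nb * M))).
  by rewrite leq_mul2r cW orbT.
rewrite big_distrl /=; apply: (leq_trans hs).
by rewrite mulnAC leq_mul2r cA orbT.
Qed.

End Tests.

(** * From the final memory to the concept class *)

Section Link.
Local Open Scope nat_scope.

(** The type of the ground set depends on the final memory, so the equation for its size is
    eliminated instead of being used for rewriting. *)
Lemma VC_concept_class (c : config) (g N : nat) (mem : nat -> nat -> bool) :
  memory c.2 0 = g -> memory c.2 1 = N ->
  (forall j x, j < N -> x < g -> (memory c.2 (2 + j * g + x) != 0) = mem j x) ->
  VC (concept_class c) = VC (class_of g N mem).
Proof.
move=> eg eN; rewrite /concept_class /concept /ground; case: _ / eg => h.
congr (VC _); rewrite /class_of -{}eN in h *; apply: eq_imset => j.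
by apply/setP => x; rewrite !inE h.
Qed.

Lemma nth_flatten_const (T : Type) (x0 : T) (ss : seq (seq T)) w i o :
  all (fun r => size r == w) ss -> i < size ss -> o < w ->
  nth x0 (flatten ss) (w * i + o) = nth x0 (nth [::] ss i) o.
Proof.
elim: ss i => [|r ss IH] [|i] //= /andP[/eqP hr hss] hi ho; rewrite nth_cat hr.
  by rewrite muln0 ho.
by rewrite mulnS -addnA ltnNge leq_addr /= addKn IH.
Qed.

Variables (md a b s : nat) (L : label_cover 'I_a 'I_b 'I_s).
Notation E := #|edges L|.
Notation ea := (edge_a L).
Notation eb := (edge_b L).
Notation tab := (edge_tab L).

Lemma is_input_encode :
  is_input md a b s E ea eb tab (fun i => nth 0 (encode md L) i).
Proof.
have enc e o : e < E -> o < s + 2 ->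
    nth 0 (encode md L) (5 + (s + 2) * e + o) =
    nth 0 [:: ea e, eb e & [seq tab e x | x <- iota 0 s]] o.
  move=> he ho; rewrite -addnA [LHS](_ : _ = nth 0 (flatten
     [seq nat_of_ord p.1 :: nat_of_ord p.2
        :: [seq nat_of_ord (proj L p x) | x <- enum 'I_s]
     | p <- enum (edges L)]) ((s + 2) * e + o)) //.
  rewrite nth_flatten_const ?size_map -?cardE //; last first.
    apply/allP => r /mapP[p _ ->].
    by rewrite /= size_map size_enum_ord addn2.
  case: (pickP (mem (edges L))) => [p0 _|h]; last by move: he; rewrite (eq_card0 h).
  have [_ h1 h2 h3] := edge_nth p0 he.
  rewrite (nth_map p0) -?cardE //.
  rewrite -h1 -h2; congr (nth _ [:: _, _ & _] _).
  apply: (@eq_from_nth _ 0) => [|i].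
    by rewrite size_map size_enum_ord size_map size_iota.
  rewrite size_map size_enum_ord => hi.
  pose x := Ordinal hi.
  rewrite (nth_map x) ?size_enum_ord // (nth_map 0) ?size_iota // nth_iota //.
  by rewrite add0n -[i]/(nat_of_ord x) nth_ord_enum h3.
split=> [|e he|e he|e x he hx]; first by [].
- by rewrite -[X in nth _ _ X]addn0 enc // addn2.
- by rewrite enc // addn2.
- rewrite -addnA enc ?ltn_add2l //; last by rewrite addnC ltn_add2r.
  by rewrite add2n /= (nth_map 0) ?size_iota // nth_iota.
Qed.

Notation nb := (nblocks a b).
Notation ns := (nassign a b s).
Notation g := (gsize a b s).
Notation nc := (nconcepts md a b s).

Definition reduction_program : seq instr := c_reduction 0.

Lemma reduction_run (B T : nat) (w : T.-tuple bool) :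
  20 <= B -> B ^ 400 <= T -> 0 < a -> 0 < s -> 0 < nb ->
  md <= B -> nv a b <= B -> s <= B -> E <= B -> nb * bsize a b <= B ->
  nb + ntest md a b <= B -> nout md a b s <= B -> nbits md a b <= B ->
  let c := run reduction_program (encode md L) w in
  [/\ halted c, #|ground c| = g, #|concept_class c| <= nc
    & VC (concept_class c) =
      VC (class_of g nc (member md a b s E ea eb tab (coin_bit w)))].
Proof.
move=> B20 BT a0 s0 nb0 h1 h2 h3 h4 h5 h6 h7 h8 c.
have hbit z : z < nbits md a b -> coin_bit w z = nth false w z by [].
have [m' [w' [hdoes hcell]]] := does_reduction B20 a0 s0 nb0 h1 h2 h3 h4 h5 h6
  h7 h8 (0, fun=> 0) is_input_encode hbit.
have [t [s' [ht hx [_ hm' _]]]] := hdoes 0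
  (State (fun=> 0) (fun i => nth 0 (encode md L) i) w)
  (conj isT (fun _ _ => erefl)) erefl erefl.
(* A halted configuration is a fixed point of [step], so the remaining steps up to [T] change
   nothing. *)
have stop N x : t <= N -> x = (reduction_program, State (fun=> 0)
    (fun i => nth 0 (encode md L) i) w) -> iter N step x = ([::], s').
  move=> htN ->; rewrite -(subnK htN) iterD /reduction_program.
  have := hx [::]; rewrite cats0 => ->.
  by elim: (N - t) => //= n ->.
have ec : c = ([::], s') by apply: stop => //; exact: leq_trans BT.
have g0 : 0 < g by rewrite ltn_addr.
have nc0 : 0 < nc by rewrite muln_gt0 !expn_gt0 s0.
have eg : memory c.2 0 = g by rewrite ec /= hm' hcell.
have eN : memory c.2 1 = nc.
  rewrite ec /= hm' hcell //; apply: (@leq_trans 2) => //; exact: leq_addr.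
split.
- by rewrite ec.
- by rewrite /ground eg card_ord.
- by apply: leq_trans (leq_imset_card _ _) _; rewrite card_ord eN.
apply: VC_concept_class => // j x hj hx'; rewrite ec /= hm' hcell; last first.
  rewrite -addnA ltn_add2l; apply: (@leq_trans (j.+1 * g)).
    by rewrite mulSn addnC ltn_add2r.
  by rewrite leq_mul2r hj orbT.
rewrite /cell -addnA !add2n /= subn2 /= divnMDl // modnMDl divn_small // modn_small //.
by rewrite addn0; case: (member _ _ _ _ _ _ _ _ _ _ _).
Qed.

End Link.

(** * Sizes of the construction *)

Section Sizes.
Local Open Scope nat_scope.
Variables a b : nat.
Notation n := (nv a b).
Notation mq := (sqrt_nv a b).
Notation nb := (nblocks a b).
Notation q := (bsize a b).

Lemma sqrt_nv_ge : n <= mq * mq.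
Proof. by apply: (searchP (P := fun z => n <= z * z) (z := n)); nia. Qed.

Lemma sqrt_nv_lt z : z < mq -> z * z < n.
Proof. by move=> /search_min; rewrite -ltnNge. Qed.

Lemma nblocks_ge : 1 < n -> 2 ^ mq <= n ^ nb.
Proof.
move=> hn; apply: (searchP (P := fun z => 2 ^ mq <= n ^ z) (z := mq)) => //.
by case: (mq) => // m; rewrite leq_exp2r.
Qed.

Lemma nblocks_lt z : z < nb -> n ^ z < 2 ^ mq.
Proof. by move=> /search_min; rewrite -ltnNge. Qed.

Lemma nblocks_le : nb <= mq. Proof. exact: search_le. Qed.

Lemma sqrt_nv_gt0 : 0 < n -> 0 < mq.
Proof. by have := sqrt_nv_ge; case: (mq) => //; rewrite mul0n => ?; lia. Qed.

Lemma nblocks_gt0 : 1 < n -> 0 < nb.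
Proof.
move=> hn; have := nblocks_ge hn; case: (nb) => //; rewrite expn0.
by have := ltn_expl mq (isT : 1 < 2); have := sqrt_nv_gt0 (ltnW hn); lia.
Qed.

Lemma bsize_ge : 0 < nb -> a <= nb * q.
Proof.
by move=> h; apply: (searchP (P := fun z => a <= nb * z) (z := a)); rewrite ?leq_pmull.
Qed.

Lemma bsize_lt z : z < q -> nb * z < a.
Proof. by move=> /search_min; rewrite -ltnNge. Qed.

Lemma slots_le : nb * q <= a + nb.
Proof.
case: (posnP q) => [->|q0]; first by rewrite muln0.
have := @bsize_lt q.-1; rewrite prednK // => /(_ (leqnn _)) h.
by rewrite -(prednK q0) mulnS addnC leq_add2r ltnW.
Qed.

(** Bounds the number of partial choices in the union bound: [ns + 1 <= s ^ (q + 1)], and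
    [nb * q <= a + nb]. *)
Lemma nassign_le s : 1 < s -> (nassign a b s).+1 ^ nb <= s ^ (3 * n).
Proof.
move=> s1; have s0 := ltnW s1; apply: (@leq_trans ((s ^ q.+1) ^ nb)).
  have h : (nassign a b s).+1 <= s ^ q.+1.
    rewrite /nassign expnS; have : 0 < s ^ q by rewrite expn_gt0 s0.
    nia.
  by case: (nb) => // z; rewrite leq_exp2r.
rewrite -expnM leq_pexp2l //.
have h1 : nb <= n by apply: (@leq_trans mq); [exact: nblocks_le|exact: search_le].
have h2 : a <= n by exact: leq_addr.
by have := slots_le; rewrite mulSn mulnC; lia.
Qed.

Lemma lbits_ge : b <= 2 ^ lbits b.
Proof.
by apply: (searchP (P := fun z => b <= 2 ^ z) (z := b)) => //; exact/ltnW/ltn_expl.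
Qed.

Lemma lbits_le : 0 < b -> 2 ^ lbits b <= 2 * b.
Proof.
move=> b0; have := @search_min (fun z => b <= 2 ^ z) b (lbits b).-1.
rewrite -/(lbits b); case: (lbits b) => [|l] /= h; first lia.
by have := h (leqnn _); rewrite -ltnNge expnS; lia.
Qed.

(** For [1 < s] both [x] and [2 ^ x] are at most [s ^ x], so all sizes are bounded by adding
    exponents. The term [4 * mq] covers [E <= n ^ 2 <= mq ^ 4], and 5 comes from [20 <= 2 ^ 5]. *)
Definition log_bound (md : nat) : nat := ntest md a b + 3 * nb + q + 4 * mq + 5.

Lemma bounds (md s E : nat) : 1 < n -> 1 < s -> E <= n * n ->
  let B := s ^ log_bound md in
  [/\ [/\ 20 <= B, md <= B, n <= B, s <= B & E <= B],
      nb * q <= B, nb + ntest md a b <= B, nout md a b s <= B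
    & nbits md a b <= B].
Proof.
move=> n1 s1 hE B; have nb0 := nblocks_gt0 n1; have s0 := ltnW s1.
have mono x y : x <= y -> s ^ x <= s ^ y by move=> ?; rewrite leq_pexp2l.
have lin x y : x <= y -> x <= s ^ y.
  by move=> xy; apply: leq_trans (mono _ _ xy); exact/ltnW/ltn_expl.
have mulB x y i j : x <= s ^ i -> y <= s ^ j -> x * y <= s ^ (i + j).
  by move=> hx hy; rewrite expnD leq_mul.
have two x y : x <= y -> 2 ^ x <= s ^ y.
  by move=> xy; apply: leq_trans (mono _ _ xy); case: x {xy} => // x; rewrite leq_exp2r.
have addB x i : x <= s ^ i -> x + x <= s ^ i.+1.
  by move=> h; rewrite expnS addnn -mul2n leq_mul.
have hn : n <= s ^ (mq + mq).
  by apply: leq_trans sqrt_nv_ge _; apply: (mulB _ _ _ _); exact: lin.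
have hk : md <= ntest md a b.
  by rewrite /ntest; apply: leq_trans (leq_pmulr _ nb0); lia.
rewrite /log_bound in B *; split; first split.
- by apply: (@leq_trans (2 ^ 5)) => //; apply: two; exact: leq_addl.
- by apply: lin; lia.
- by apply: leq_trans hn (mono _ _ _); lia.
- by rewrite -{1}(expn1 s); apply: mono; lia.
- by apply: leq_trans hE _; apply: leq_trans (mulB _ _ _ _ hn hn) (mono _ _ _); lia.
- apply: (@leq_trans (s ^ (nb + q))); last by apply: mono; lia.
  by apply: (mulB _ _ _ _); exact: lin.
- by apply: lin; lia.
- rewrite /nout; apply: (@leq_trans (s ^ (ntest md a b + 3 * nb + q + 2).+1)); last first.
    by apply: mono; lia.
  rewrite expnS; set Y := s ^ _; have hY2 : 2 <= Y by apply: (two 1); lia.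
  have h : nconcepts md a b s * gsize a b s <= Y.
    rewrite /nconcepts /gsize /Y.
    apply: (@leq_trans (s ^ ((nb + ntest md a b) + nb + (nb + q).+1))); last first.
      by apply: mono; lia.
    apply: (mulB _ _ _ _); first by apply: (mulB _ _ _ _) => //; exact: two.
    apply: (@leq_trans (s ^ (nb + q) + s ^ (nb + q))); last exact: addB.
    by apply: leq_add; [apply: lin; lia|rewrite mulnC; apply: (mulB _ _ _ _) => //; exact: lin].
  by apply: (@leq_trans (2 * Y)); [lia|rewrite leq_mul2r s1 orbT].
- apply: (@leq_trans (s ^ (nb + ntest md a b + (mq + mq)))); last by apply: mono; lia.
  apply: (mulB _ _ _ _); first by apply: (mulB _ _ _ _); [exact: two|exact: lin].
  apply: leq_trans hn; apply: (@leq_trans b); [exact: search_le|exact: leq_addl].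
Qed.

End Sizes.

(** * Real estimates of the sizes in terms of r *)

Section Estimates.
Variable R : realType.
Implicit Types x y : R.

Lemma ln2_gt0 : 0 < ln (2 : R).
Proof. by rewrite ln_gt0 // ltr1n. Qed.

Lemma ler_log2 x y : 0 < x -> x <= y -> log2 x <= log2 y.
Proof.
move=> x0 xy; rewrite /log2 ler_pM2r ?invr_gt0 ?ln2_gt0 //.
by rewrite ler_ln ?posrE // (lt_le_trans x0).
Qed.

Lemma log2X x (j : nat) : 0 < x -> log2 (x ^+ j) = j%:R * log2 x.
Proof. by move=> x0; rewrite /log2 lnXn // -[ln x *+ j]mulr_natl mulrA. Qed.

Lemma log2_2 : log2 (2 : R) = 1.
Proof. by rewrite /log2 divff // gt_eqF // ln2_gt0. Qed.

Lemma log2_expn (j : nat) : log2 ((2 ^ j)%N%:R : R) = j%:R.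
Proof. by rewrite natrX log2X // log2_2 mulr1. Qed.

Lemma log2_ge1 (n : nat) : (1 < n)%N -> 1 <= log2 (n%:R : R).
Proof. by move=> n1; rewrite -[leLHS]log2_2 ler_log2 // ler_nat. Qed.

Lemma log2_le_nat (n : nat) : (0 < n)%N -> log2 (n%:R : R) <= n%:R.
Proof.
move=> n0; rewrite -[leRHS]log2_expn ler_log2 ?ltr0n // ler_nat.
exact/ltnW/ltn_expl.
Qed.

Lemma log2_le_inv x y : 0 < x -> 0 < y -> log2 x <= log2 y -> x <= y.
Proof.
by move=> x0 y0; rewrite /log2 ler_pM2r ?invr_gt0 ?ln2_gt0 // ler_ln ?posrE.
Qed.

(** For x = n^(1/8), log2 n = 8 log2 x <= 8 (x + 1) <= 16 x. Hence M (log2 n)^2 <= 256 M x^2, which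
    is at most x^4 = sqrt n once x >= 256 M. *)
Lemma r_of_large (M : R) : 0 <= M ->
  exists n0, forall n, (n0 <= n)%N -> M * log2 n%:R <= r_of R n.
Proof.
move=> M0; pose u := (Num.truncn (256 * M)).+2.
exists (u ^ 8)%N => n hn.
have n1 : (1 < n)%N.
  by apply: leq_trans hn; rewrite -{1}(exp1n 8) ltn_exp2r.
have hM : 256 * M <= u%:R.
  apply: ltW; apply: (lt_le_trans (truncnS_gt _)).
  by rewrite ler_nat.
pose x := Num.sqrt (Num.sqrt (Num.sqrt (n%:R : R))).
have x4 : x ^+ 4 = Num.sqrt n%:R by rewrite (exprM x 2 2) !sqr_sqrtr // sqrtr_ge0.
have x8 : x ^+ 8 = n%:R by rewrite (exprM x 4 2) x4 sqr_sqrtr // ler0n.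
have x0 : 0 <= x by exact: sqrtr_ge0.
have ux : u%:R <= x.
  rewrite -(@ler_pXn2r _ 8) ?nnegrE ?ler0n //.
  by rewrite x8 -natrX ler_nat.
have x1 : 1 <= x by apply: le_trans ux; rewrite ler1n.
have lg1 := log2_ge1 n1; have lg0 : 0 < log2 (n%:R : R) by exact: lt_le_trans lg1.
pose v := (Num.truncn x).+1.
have xv : x < v%:R by exact: truncnS_gt.
have vx : v%:R <= x + 1.
  by rewrite /v -natr1 lerD2r truncn_le.
have hlg : log2 (n%:R : R) <= 16 * x.
  rewrite -x8 log2X ?(lt_le_trans _ x1) //.
  have h1 : log2 x <= v%:R.
    by apply: le_trans (log2_le_nat _) => //; rewrite ler_log2 ?(lt_le_trans _ x1) ?ltW.
  lra.
have hMx : 256 * M <= x ^+ 2.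
  by apply: (le_trans hM); apply: (le_trans ux); rewrite expr2 ler_peMr.
rewrite /r_of -x4 ler_pdivlMr // -mulrA.
apply: (@le_trans _ _ (M * (16 * x * (16 * x)))).
  by rewrite ler_wpM2l // ler_pM // ltW.
have -> : M * (16 * x * (16 * x)) = 256 * M * x ^+ 2 by ring.
by rewrite (exprM x 2 2) [leRHS]expr2 ler_wpM2r // exprn_ge0.
Qed.

Section Fixed.
Variables a b : nat.
Notation n := (nv a b).
Notation mq := (sqrt_nv a b).
Notation nb := (nblocks a b).
Notation q := (bsize a b).
Notation r := (r_of R n).
Hypothesis n1 : (1 < n)%N.

Let lg1 : 1 <= log2 (n%:R : R). Proof. exact: log2_ge1. Qed.
Let lg0 : 0 < log2 (n%:R : R). Proof. exact: lt_le_trans lg1. Qed.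
Let n0 : (0 : R) < n%:R. Proof. by rewrite ltr0n ltnW. Qed.

Lemma r_of_gt0 : 0 < r.
Proof. by rewrite /r_of divr_gt0 // sqrtr_gt0. Qed.

Lemma sqrt_nv_bounds :
  Num.sqrt (n%:R : R) <= mq%:R /\ mq%:R <= Num.sqrt (n%:R : R) + 1.
Proof.
split.
  rewrite -(@ler_pXn2r _ 2) ?nnegrE ?sqrtr_ge0 //.
  by rewrite sqr_sqrtr ?ler0n // -natrX ler_nat -mulnn sqrt_nv_ge.
have mq0 := sqrt_nv_gt0 (ltnW n1).
rewrite -(prednK mq0) -natr1 lerD2r.
rewrite -(@ler_pXn2r _ 2) ?nnegrE ?sqrtr_ge0 //.
rewrite sqr_sqrtr ?ler0n // -natrX ler_nat -mulnn ltnW //.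
by apply: sqrt_nv_lt; rewrite prednK.
Qed.

(** Both roundings, of the square root and of the quotient, go upwards, and each adds at most 1
    because log2 n >= 1. *)
Lemma nblocks_bounds : r <= nb%:R /\ nb%:R <= r + 2.
Proof.
have [h1 h2] := sqrt_nv_bounds.
split; rewrite /r_of.
  rewrite ler_pdivrMr //; apply: le_trans h1 _.
  rewrite -log2X // -natrX -[leLHS]log2_expn ler_log2 ?ltr0n ?expn_gt0 //.
  by rewrite ler_nat nblocks_ge.
have nb0 := nblocks_gt0 n1.
rewrite -lerBlDr ler_pdivlMr //.
have : nb.-1%:R * log2 (n%:R : R) <= mq%:R.
  rewrite -log2X // -natrX -[leRHS]log2_expn ler_log2 ?ltr0n ?expn_gt0 ?(ltnW n1) //.
  by rewrite ler_nat ltnW // nblocks_lt // prednK.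
have -> : nb%:R = nb.-1%:R + 1 :> R by rewrite natr1 prednK.
by move: lg1; nra.
Qed.

(** Everything is charged to Q = E / r. With t = 1/delta + 1 the summands give 96 t Q for the tests
    and 29 Q + 6 for the rest, and 6 <= 12 Q, so 137 t Q in all. *)
Lemma log_bound_le (delta : R) (E : nat) : 0 < delta -> (a <= E)%N -> (b <= E)%N ->
  (log_bound a b (delta_code delta))%:R <= 140 * (delta^-1 + 1) * (E%:R / r).
Proof.
move=> d0 aE bE; set Q := E%:R / r.
have [h1 h2] := sqrt_nv_bounds; have [h3 h4] := nblocks_bounds.
have nb0 := nblocks_gt0 n1; have r0 := r_of_gt0.
have s0 : 0 < Num.sqrt (n%:R : R) by rewrite sqrtr_gt0.
have s1 : 1 <= Num.sqrt (n%:R : R) by rewrite -[leLHS]sqrtr1 ler_sqrt ?ler0n // ler1n ltnW.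
(* As every vertex has an edge, n = a + b <= 2 E; the factor log2 n in Q is at least 1. *)
have hQ : Num.sqrt (n%:R : R) <= 2 * Q.
  have -> : 2 * Q = 2 * E%:R * log2 n%:R / Num.sqrt n%:R.
    by rewrite /Q /r_of; field; rewrite !gt_eqF.
  rewrite ler_pdivlMr // -expr2 sqr_sqrtr ?ler0n //.
  have nE : (n%:R : R) <= 2 * E%:R by rewrite -natrM ler_nat /nv; lia.
  by apply: (le_trans nE); rewrite ler_peMr // mulr_ge0.
have Q0 : 0 <= Q by rewrite divr_ge0 // ltW.
set md := delta_code delta; set t := delta^-1 + 1.
have t1 : 1 <= t by rewrite /t lerDr invr_ge0 ltW.
have hmd : md%:R <= t.
  rewrite /md /delta_code natr_absz ger0_norm; last first.
    by rewrite ceil_ge0 (lt_trans (ltrN10 _)) // invr_gt0.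
  by have := ceilB1_lt delta^-1; rewrite intrB mulr1z /t; lra.
have hnb : (nb%:R : R) <= 4 * Q.
  have : (nb%:R : R) <= mq%:R by rewrite ler_nat nblocks_le.
  lra.
have hk : ((ntest md a b)%:R : R) <= 96 * (t * Q).
  have -> : 96 * (t * Q) = 24 * t * (4 * Q) by ring.
  by rewrite /ntest !natrM ler_pM // ?mulr_ge0 // ler_pM2l.
have hq : (q%:R : R) <= Q + 1.
  case: (posnP q) => [->|q0]; first by rewrite addr_ge0.
  rewrite -(prednK q0) -natr1 lerD2r ler_pdivlMr //.
  apply: (@le_trans _ _ (q.-1%:R * nb%:R)); first by rewrite ler_wpM2l.
  rewrite -natrM ler_nat; apply: leq_trans aE; rewrite mulnC ltnW //.
  by apply: bsize_lt; rewrite prednK.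
have hQt : Q <= t * Q by rewrite ler_peMl.
rewrite /log_bound -/md 4!natrD (natrM _ 3 nb) (natrM _ 4 mq) -mulrA; lra.
Qed.

End Fixed.
End Estimates.

(** * Soundness *)

(** The same threshold serves twice. Among [2 ^ nb] lists, a shattered set of more than [N] elements
    must meet at least [N.+1 - nb] blocks; having at most [nb] representatives, it has at least
    [N.+1 - nb] other elements, whose subsets give that power of two as the number of passed
    lists. *)
Lemma not_fooled_VC (md a b s E T N : nat) (ea eb : nat -> nat)
    (tab : nat -> nat -> nat) (w : T.-tuple bool) : (0 < s)%N ->
  ~~ @fooled md a b s E ea eb tab T (N.+1 - nblocks a b) w ->
  (VC (class_of (gsize a b s) (nconcepts md a b s)
    (member md a b s E ea eb tab (coin_bit w))) <= N)%N.
Proof.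
move=> s0 nf; apply/bigmax_leqP => W shW; rewrite leqNgt; apply/negP => hN.
have [rep hrep] := shattered_passes s0 shW; move/existsP: nf; apply; exists rep.
have hJ : (#|W| - #|chosen rep| <= nblocks a b)%N.
  rewrite -(@leq_exp2l 2) //; apply: (leq_trans hrep).
  by apply: leq_trans (max_card _) _; rewrite card_ord.
have hJ2 : (#|chosen rep| <= nblocks a b)%N.
  by apply: leq_trans (max_card _) _; rewrite card_ord.
apply/andP; split; first by lia.
by apply: leq_trans hrep; rewrite leq_exp2l //; lia.
Qed.

Section Soundness.
Variables (R : realType) (a b s : nat) (L : label_cover 'I_a 'I_b 'I_s).
Notation n := (nv a b).
Notation nb := (nblocks a b).
Notation q := (bsize a b).
Notation r := (r_of R n).
Notation E := #|edges L|.
Notation maxsat := (\max_(phi : {ffun 'I_a + 'I_b -> 'I_s}) #|satisfied L phi|).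
Hypotheses (bireg : biregular L) (E0 : edges L != set0) (s1 : (1 < s)%N).

Lemma edges_facts : exists dA dB, [/\ forall v, degA L v = dA,
  forall v, degB L v = dB, E = (a * dA)%N, E = (b * dB)%N
  & [/\ (0 < a)%N, (0 < b)%N, (0 < dA)%N & (0 < dB)%N]].
Proof.
have [[dA hA] [dB hB]] := bireg; exists dA, dB.
have eA : E = (a * dA)%N.
  have := card_edges_inA [set: 'I_a] hA; rewrite cardsT card_ord => <-.
  by apply: eq_card => p; rewrite !inE andbT.
have eB : E = (b * dB)%N.
  have := card_edges_inB [set: 'I_b] hB; rewrite cardsT card_ord => <-.
  by apply: eq_card => p; rewrite !inE andbT.
have Egt0 : (0 < E)%N by rewrite card_gt0.
split=> //; move: (Egt0); rewrite eA muln_gt0 => /andP[-> ->].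
by move: Egt0; rewrite eB muln_gt0 => /andP[-> ->].
Qed.

(** One edge and regularity make all degrees positive, so each side has at most [E] vertices. *)
Lemma sizes_le : [/\ (a <= E)%N, (b <= E)%N, (E <= n * n)%N & (1 < n)%N].
Proof.
have [dA [dB [_ _ eA eB [a0 b0 dA0 dB0]]]] := edges_facts.
split; [by rewrite eA leq_pmulr|by rewrite eB leq_pmulr| |exact: leq_add a0 b0].
apply: leq_trans (max_card _) _; rewrite card_prod !card_ord leq_mul //.
  exact: leq_addr.
exact: leq_addl.
Qed.

Variable delta : R.
Hypothesis delta_gt0 : 0 < delta.
Notation md := (delta_code delta).
Notation h := ((Num.truncn ((1 + delta) * r)).+1 - nb)%N.

Lemma delta_code_ge : 1 <= md%:R * delta.
Proof.
have h0 : 0 < delta^-1 by rewrite invr_gt0.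
rewrite -[leLHS](@mulVf _ delta) ?gt_eqF // ler_wpM2r ?(ltW delta_gt0) //.
rewrite /delta_code natr_absz ger0_norm ?ceil_ge //.
by rewrite ceil_ge0 (lt_trans (ltrN10 _)).
Qed.

Lemma delta_code_gt0 : (0 < md)%N.
Proof. by have := delta_code_ge; case: md => //; rewrite mul0r ler10. Qed.

Lemma h_gt : delta * r - 2 < h%:R.
Proof.
have [_ hnb] := nblocks_bounds R (let: And4 _ _ _ n1 := sizes_le in n1).
have h1 : (1 + delta) * r < (Num.truncn ((1 + delta) * r)).+1%:R.
  exact: truncnS_gt.
have h2 : ((Num.truncn ((1 + delta) * r)).+1%:R : R) <= h%:R + nb%:R.
  by rewrite -natrD ler_nat addnC -leq_subLR.
by set N := _.+1 in h1 h2 *; rewrite mulrDl mul1r in h1; lra.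
Qed.

(** The chosen blocks reach a fraction 0.35 delta of [A], hence of the edges. At most 0.012 delta of
    the edges can be satisfied, so more than delta / 4 of them end at inconsistent vertices, and
    regularity on the side of [B] turns this into a fraction of the vertices. *)
Lemma few_good (rep : choice_of a b s) :
  20 <= r -> 9 <= delta * r -> lc_val R L <= delta ^+ 2 / 100 ->
  (h <= #|chosen rep|)%N ->
  (8 * md * #|good E (edge_a L) (edge_b L) (edge_tab L) rep|
     <= (8 * md).-1 * 2 ^ lbits b)%N.
Proof.
move=> r20 dr9 hval hrep.
have [dA [dB [hA hB eA eB [a0 b0 dA0 dB0]]]] := edges_facts.
have [aE bE EE n1] := sizes_le.
have nb0 := nblocks_gt0 n1; have [_ hnb] := nblocks_bounds R n1.
set I := #|[set v : 'I_b | ~~ consistent E (edge_a L) (edge_b L) (edge_tab L) rep v]|.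
have A1 := card_reached rep a0 (bsize_ge nb0).
have A2 := inconsistent_many rep a0 (ltnW s1) hA hB; rewrite -/I in A2.
have hE : (0 : R) < E%:R by rewrite ltr0n card_gt0.
have hsat : (maxsat%:R : R) <= delta ^+ 2 / 100 * E%:R.
  by move: hval; rewrite /lc_val ler_pdivrMr.
have hh := h_gt.
have hJ : (h%:R : R) <= #|chosen rep|%:R by rewrite ler_nat.
have hJ2 : (#|chosen rep|%:R : R) <= nb%:R.
  by rewrite ler_nat; apply: leq_trans (max_card _) _; rewrite card_ord.
(* From delta r - 2 < h <= nb <= r + 2 and 20 <= r. It lets the quadratic bound on the value be
   charged linearly in delta. *)
have d12 : delta <= 12 / 10.
  have : delta * r <= 12 / 10 * r by lra.
  by rewrite ler_pM2r // (lt_le_trans _ r20).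
have nbR : (0 : R) < nb%:R by rewrite ltr0n.
(* |chosen| >= h >= (7/9) delta r and 2 nb <= 2.2 r *)
have hJd : 7 / 10 * delta * nb%:R <= #|chosen rep|%:R.
  apply: le_trans hJ; apply: (@le_trans _ _ (7 / 10 * delta * (11 / 10 * r))).
    by rewrite ler_wpM2l ?mulr_ge0 ?(ltW delta_gt0) //; lra.
  by lra.
have hreach : 35 / 100 * delta * a%:R <= #|reached rep|%:R.
  have : (#|chosen rep|%:R * a%:R : R) <= 2 * nb%:R * #|reached rep|%:R.
    by rewrite -!natrM ler_nat.
  have aR : (0 : R) < a%:R by rewrite ltr0n.
  move=> h1; rewrite -(ler_pM2l (_ : 0 < 2 * nb%:R)) ?mulr_gt0 //.
  apply: le_trans h1.
  have -> : 2 * nb%:R * (35 / 100 * delta * a%:R) = 7 / 10 * delta * nb%:R * a%:R :> R.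
    by field.
  by rewrite ler_wpM2r // ltW.
have hinc : b%:R * (delta / 4) <= (I%:R : R).
  have dBR : (0 : R) < dB%:R by rewrite ltr0n.
  rewrite -(ler_pM2r dBR).
  have -> : b%:R * (delta / 4) * dB%:R = E%:R * (delta / 4) :> R.
    by rewrite eB natrM; ring.
  have h1 : (#|reached rep|%:R * dA%:R : R) <= maxsat%:R + I%:R * dB%:R.
    by rewrite -!natrM -natrD ler_nat.
  have h2 : 35 / 100 * delta * E%:R <= (#|reached rep|%:R * dA%:R : R).
    have -> : 35 / 100 * delta * E%:R = 35 / 100 * delta * a%:R * dA%:R :> R.
      by rewrite eA natrM; ring.
    by rewrite ler_wpM2r.
  have h3 : delta ^+ 2 / 100 * E%:R <= 12 / 1000 * delta * E%:R.
    rewrite ler_wpM2r ?(ltW hE) //; have : delta * delta <= 12 / 10 * delta.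
      by rewrite ler_pM2r.
    by rewrite expr2; lra.
  have h4 : 0 <= delta * E%:R by rewrite mulr_ge0 // ltW.
  have h5 : 35 / 100 * delta * E%:R = 35 / 100 * (delta * E%:R) :> R by ring.
  have h6 : 12 / 1000 * delta * E%:R = 12 / 1000 * (delta * E%:R) :> R by ring.
  have -> : E%:R * (delta / 4) = (delta * E%:R) / 4 :> R by ring.
  by lra.
have hbI : (b <= 4 * md * I)%N.
  rewrite -(ler_nat R) !natrM.
  have mdR : (0 : R) <= md%:R by rewrite ler0n.
  have hm := delta_code_ge.
  apply: (@le_trans _ _ (md%:R * delta * b%:R)); first by rewrite ler_peMl.
  have -> : md%:R * delta * b%:R = 4 * md%:R * (b%:R * (delta / 4)) :> R by field.
  by rewrite ler_wpM2l // mulr_ge0.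
(* Rounding [b] up to a power of two at most doubles it, which turns [4 * md] into [8 * md]. *)
have hl := lbits_le b0.
have hg := card_good E (edge_a L) (edge_b L) (edge_tab L) rep (lbits_ge b).
rewrite -/I in hg; have m0 := delta_code_gt0.
rewrite -subn1 mulnBl mul1n; set g := #|good _ _ _ _ _| in hg *.
have hgI : (8 * md * g + 8 * md * I <= 8 * md * 2 ^ lbits b)%N.
  by rewrite -mulnDr leq_mul2l hg orbT.
move: hgI hl hbI; generalize (2 ^ lbits b)%N md g I; clear; lia.
Qed.

Lemma few_fooled (T : nat) : 20 <= r ->
  log2 (1000 * n%:R * log2 s%:R) / r <= delta ->
  lc_val R L <= delta ^+ 2 / 100 -> (nbits md a b <= T)%N ->
  (#|[set w : T.-tuple bool |
      @fooled md a b s E (edge_a L) (edge_b L) (edge_tab L) T h w]| * 2 ^ n <= 2 ^ T)%N.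
Proof.
move=> r20 hdelta hval hT.
have [aE bE EE n1] := sizes_le; have s0 := ltnW s1.
have r0 := r_of_gt0 R n1; have nb0 := nblocks_gt0 n1.
have ls1 : 1 <= log2 (s%:R : R) by exact: log2_ge1.
have nR : (0 : R) < n%:R by rewrite ltr0n ltnW.
have hY : log2 (1000 * n%:R * log2 s%:R : R) <= delta * r.
  by move: hdelta; rewrite ler_pdivrMr.
set Y := 1000 * n%:R * log2 s%:R : R in hY.
have ls0 : 0 < log2 (s%:R : R) by exact: lt_le_trans ls1.
have Y0 : 0 < Y by rewrite /Y mulr_gt0 // mulr_gt0 // ltr0n.
(* 9 = log2 512, and 512 <= 1000. *)
have dr9 : 9 <= delta * r.
  apply: le_trans hY; rewrite -[leLHS]log2_expn ler_log2 ?ltr0n ?expn_gt0 //.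
  apply: (@le_trans _ _ (1000 * n%:R)); last by rewrite /Y ler_peMr // mulr_ge0 // ltW.
  by rewrite -natrM ler_nat; apply: (@leq_trans 1000) => //; rewrite leq_pmulr // ltnW.
(* The loss of 2 in [h_gt] is the factor 4 between 1000 and 250. *)
have hM : 250 * n%:R * log2 s%:R <= (2 ^ h)%N%:R :> R.
  have : Y <= (2 ^ (h + 2))%N%:R.
    apply: log2_le_inv => //; first by rewrite ltr0n expn_gt0.
    by rewrite log2_expn natrD; apply: (le_trans hY); have := h_gt; lra.
  have -> : Y = 4 * (250 * n%:R * log2 s%:R).
    by rewrite /Y !mulrA -(natrM _ 4 250).
  by rewrite expnD natrM [leRHS]mulrC ler_pM2l // ltr0n.
have {hM} hM : (s ^ (250 * n) <= 2 ^ 2 ^ h)%N.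
  rewrite -(ler_nat R); apply: log2_le_inv; rewrite ?ltr0n ?expn_gt0 ?s0 //.
  by rewrite log2_expn natrX log2X ?ltr0n // natrM.
have := card_fooled hT delta_code_gt0 (fun rep => @few_good rep r20 dr9 hval).
set F := #|_|; set M := (2 ^ h)%N in hM * => hF.
have hS := nassign_le a b s1.
have p0 : (0 < s ^ (3 * n))%N by rewrite expn_gt0 s0.
rewrite -(leq_pmul2l p0).
apply: leq_trans (leq_trans _ hF) (leq_mul hS (leqnn _)).
rewrite mulnCA leq_mul2l; apply/orP; right.
(* The choices of assignments account for [s ^ (3 * n)], and the desired factor [2 ^ n] is at most
   [s ^ n]. *)
apply: (@leq_trans (s ^ (3 * n) * s ^ n)).
  by rewrite leq_mul2l; apply/orP; right; rewrite leq_exp2r // ltnW.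
rewrite -expnD; apply: (@leq_trans (s ^ (250 * n))).
  by rewrite leq_pexp2l // -mulSnr leq_mul2r orbT.
apply: (leq_trans hM); rewrite leq_pexp2l // leq_pmull //.
by rewrite muln_gt0 /= (nblocks_gt0 n1).
Qed.

End Soundness.

(** * The size bound, correctness for each coin sequence, and probabilities *)

Section Main.
Variable R : realType.

(** 400 is the exponent of [B] in the running time, and 140 (1/delta + 1) is the factor in
    [log_bound_le]. *)
Definition exponent_poly : {poly R} := (400 * 140)%:P * ('X + 1).

Section Instance.
Variables (a b s : nat) (L : label_cover 'I_a 'I_b 'I_s) (delta : R).
Hypotheses (bireg : biregular L) (E0 : edges L != set0) (s1 : (1 < s)%N).
Hypothesis delta_gt0 : 0 < delta.
Notation md := (delta_code delta).
Notation B := (s ^ log_bound a b md)%N.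
Notation E := #|edges L|.

Lemma size_bound_ge : (B ^ 400)%N%:R <= size_bound L exponent_poly delta.
Proof.
have [aE bE EE n1] := sizes_le bireg E0.
have r0 := r_of_gt0 R n1.
rewrite -expnM natrX -powR_mulrn ?ler0n // /size_bound ler_powR ?ler1n ?(ltnW s1) //.
rewrite /exponent_poly hornerM hornerC hornerD hornerX hornerC natrM.
have h := log_bound_le n1 delta_gt0 aE bE.
apply: (@le_trans _ _ (140 * (delta^-1 + 1) * (E%:R / r_of R (a + b)) * 400)).
  by rewrite ler_wpM2r.
rewrite le_eqVlt; apply/orP; left; apply/eqP; field.
by rewrite !gt_eqF.
Qed.

Lemma time_bound_ge : (B ^ 400 <= time_bound L exponent_poly delta)%N.
Proof. by rewrite /time_bound truncn_ge_nat ?powR_ge0 // size_bound_ge. Qed.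

Lemma nbits_le_time : (nbits md a b <= time_bound L exponent_poly delta)%N.
Proof.
have [aE bE EE n1] := sizes_le bireg E0.
apply: leq_trans time_bound_ge; have [_ _ _ _ h] := bounds md n1 s1 EE.
by apply: (leq_trans h); rewrite -{1}(expn1 B) leq_pexp2l // expn_gt0 (ltnW s1).
Qed.

Notation h := ((Num.truncn ((1 + delta) * r_of R (a + b))).+1 - nblocks a b)%N.

Lemma satisfiable_labels : satisfiable R L -> exists fa fb : nat -> nat,
  [/\ forall v, (fa v < s)%N, forall v, (fb v < s)%N &
      forall e, (e < E)%N -> edge_tab L e (fa (edge_a L e)) = fb (edge_b L e)].
Proof.
have [dA [dB [_ _ _ _ [a0 _ _ _]]]] := edges_facts bireg E0.
have s0 := ltnW s1; have ER : (E%:R : R) != 0 by rewrite pnatr_eq0 cards_eq0.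
have card0 : (0 < #|{ffun 'I_a + 'I_b -> 'I_s}|)%N.
  by rewrite card_ffun expn_gt0 card_ord s0.
rewrite /satisfiable /lc_val; have [phi ->] := bigop.eq_bigmax (fun phi => #|satisfied L phi|) card0.
rewrite -(inj_eq (mulIf ER)) divfK // mul1r eqr_nat => /eqP hE.
have eqE : satisfied L phi = edges L.
  by apply/eqP; rewrite eqEcard hE leqnn andbT; apply/subsetP => p; rewrite inE => /andP[].
exists (fun v => if insub v is Some i then nat_of_ord (phi (inl i)) else 0%N).
exists (fun v => if insub v is Some i then nat_of_ord (phi (inr i)) else 0%N).
split=> [v|v|e he]; [by case: insub|by case: insub|].
case/set0Pn: E0 => p0 _; have := edge_nth p0 he; set p := nth _ _ _ => -[pE -> -> htab].
by rewrite !valK htab; move: pE; rewrite -eqE inE => /andP[_ /eqP ->].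
Qed.

Lemma reduction_correct (w : (time_bound L exponent_poly delta).-tuple bool) :
  let c := reduction L reduction_program exponent_poly delta w in
  [/\ size_property L exponent_poly delta c, completeness_property R L c &
      ~~ @fooled md a b s E (edge_a L) (edge_b L) (edge_tab L) _ h w ->
      soundness_property L delta c].
Proof.
have [aE bE EE n1] := sizes_le bireg E0; have s0 := ltnW s1.
have [dA [dB [_ _ _ _ [a0 _ _ _]]]] := edges_facts bireg E0.
have nb0 := nblocks_gt0 n1; have r0 := r_of_gt0 R n1.
have [[b1 b2 b3 b4 b5] b6 b7 b8 b9] := bounds md n1 s1 EE.
have := reduction_run w b1 time_bound_ge a0 s0 nb0 b2 b3 b4 b5 b6 b7 b8 b9.
rewrite -/(reduction L reduction_program exponent_poly delta w).
set c := reduction _ _ _ _ w => -[hh hg hC hV].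
have B0 : (0 < B)%N by exact: leq_trans b1.
have le_size z : (z <= B)%N -> z%:R <= size_bound L exponent_poly delta.
  move=> hz; apply: le_trans size_bound_ge; rewrite ler_nat; apply: (leq_trans hz).
  by rewrite -{1}(expn1 B) leq_pexp2l.
have nsg0 : (0 < gsize a b s)%N by rewrite ltn_addr.
have nc0 : (0 < nconcepts md a b s)%N by rewrite muln_gt0 !expn_gt0 s0.
have prodB : (nconcepts md a b s * gsize a b s <= B)%N.
  by apply: leq_trans b8; exact: leq_addl.
split.
- rewrite /size_property hh andTb !le_size //.
    by rewrite hg; apply: leq_trans prodB; rewrite leq_pmull.
  by apply: (leq_trans hC); apply: leq_trans prodB; rewrite leq_pmulr.
- apply/implyP => /satisfiable_labels[fa [fb [ha hb sat]]]; rewrite hV.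
  have hc := completeness_VC md a b (coin_bit w) s1 ha hb sat.
  have [hr _] := nblocks_bounds R n1.
  apply: (@le_trans _ _ (nblocks a b + nblocks a b)%N%:R); last by rewrite ler_nat.
  by rewrite natrD mulr2n mulrDl mul1r lerD.
- move=> nf; apply/implyP => _; rewrite hV.
  have := not_fooled_VC s0 nf; rewrite -(ler_nat R) => /le_trans; apply.
  by rewrite truncn_le mulr_ge0 ?addr_ge0 ?(ltW delta_gt0) ?(ltW r0).
Qed.

End Instance.

Lemma expn2_inv_le (eps : R) : 0 < eps ->
  exists n0, forall n, (n0 <= n)%N -> (2 ^+ n)^-1 <= eps.
Proof.
move=> e0; exists (Num.truncn eps^-1).+1 => n hn.
rewrite -[leRHS]invrK lef_pV2 ?posrE ?invr_gt0 ?exprn_gt0 //.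
apply: ltW; apply: (lt_le_trans (truncnS_gt _)).
by rewrite -natrX ler_nat; apply: (leq_trans hn); exact/ltnW/ltn_expl.
Qed.

(** The failure probability is at most 2^(-n) for all admissible delta and [s], so the threshold
    depends on [eps] alone. *)
Lemma soundness_likely (eps : R) : 0 < eps -> exists n0,
  forall (a b s : nat) (L : label_cover 'I_a 'I_b 'I_s) (delta : R),
    biregular L -> edges L != set0 -> (1 < s)%N -> (n0 <= a + b)%N -> 0 < delta ->
    log2 (1000 * (a + b)%:R * log2 s%:R) / r_of R (a + b) <= delta ->
    1 - eps <= Pr (fun w : (time_bound L exponent_poly delta).-tuple bool =>
      soundness_property L delta (reduction L reduction_program exponent_poly delta w)).
Proof.
move=> e0; have [k1 h1] := expn2_inv_le e0.
have [k2 h2] := r_of_large (ler0n R 20).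
exists (maxn k1 k2) => a b s L delta bireg E0 s1; rewrite geq_max => /andP[n1 n2] d0 hd.
have [_ _ _ nn] := sizes_le bireg E0.
set T := time_bound L exponent_poly delta; set ev := fun w => _.
have T0 : (0 : R) < 2 ^+ T by rewrite exprn_gt0.
have r20 : 20 <= r_of R (a + b).
  by apply: le_trans (h2 _ n2); rewrite ler_peMr // log2_ge1.
pose h := ((Num.truncn ((1 + delta) * r_of R (a + b))).+1 - nblocks a b)%N.
pose F := [set w : T.-tuple bool | @fooled (delta_code delta) a b s #|edges L|
   (edge_a L) (edge_b L) (edge_tab L) T h w].
rewrite /Pr ler_pdivlMr //.
have [hval|/negbTE hval] := boolP (lc_val R L <= delta ^+ 2 / 100); last first.
  have -> : [set w | ev w] = setT.
    by apply/setP => w; rewrite !inE /ev /soundness_property hval.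
  rewrite cardsT card_tuple card_bool natrX ler_piMl ?(ltW T0) //.
  by rewrite lerBlDr lerDl ltW.
have hF := few_fooled bireg E0 s1 d0 r20 hd hval (nbits_le_time bireg E0 s1 d0).
rewrite -/h -/T -/F in hF.
have hFR : (#|F|%:R : R) <= eps * 2 ^+ T.
  have p0 : (0 : R) < 2 ^+ nv a b by rewrite exprn_gt0.
  apply: (@le_trans _ _ ((2 ^+ nv a b)^-1 * 2 ^+ T)); last first.
    by rewrite ler_pM2r // h1.
  by rewrite mulrC ler_pdivlMr // -!natrX -natrM ler_nat.
have hsub : (2 ^ T <= #|[set w | ev w]| + #|F|)%N.
  rewrite -[X in (X ^ T)%N]card_bool -card_tuple -cardsT -(setUCr F) setUC.
  apply: leq_trans (leq_card_setU _ _) _; rewrite leq_add2r; apply: subset_leq_card.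
  apply/subsetP => w; rewrite !inE => hw.
  by have [_ _] := reduction_correct bireg E0 s1 d0 w; apply.
have : (2 ^+ T : R) <= #|[set w | ev w]|%:R + #|F|%:R.
  by rewrite -natrX -natrD ler_nat.
by rewrite mulrBl mul1r lerBlDr => /le_trans; apply; rewrite lerD2l.
Qed.

(** For bounded [s] the numerator is at most log2 (1000 s0) + log2 n, which is O(log2 n), while r
    exceeds every multiple of log2 n. *)
Lemma admissible_delta (delta : R) (s0 : nat) : 0 < delta -> exists n0,
  forall a b s, (1 < s)%N -> (s <= s0)%N -> (n0 <= a + b)%N -> (1 < a + b)%N ->
    log2 (1000 * (a + b)%:R * log2 s%:R) / r_of R (a + b) <= delta.
Proof.
move=> d0; pose M := ((1000 * s0)%N%:R + 1) / delta.
have M0 : 0 <= M by rewrite divr_ge0 ?addr_ge0 // ltW.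
have [n0 h] := r_of_large M0; exists n0 => a b s s1 ss0 hn n1.
have r0 : 0 < r_of R (a + b) by exact: (r_of_gt0 R n1).
have nR : (0 : R) < (a + b)%:R by rewrite ltr0n ltnW.
have lg1 : 1 <= log2 ((a + b)%:R : R) by exact: log2_ge1.
have ls1 : 1 <= log2 (s%:R : R) by exact: log2_ge1.
have s00 : (0 < 1000 * s0)%N by rewrite muln_gt0 /= (leq_trans (ltnW s1) ss0).
have sR : (0 : R) < (1000 * s0)%N%:R by rewrite ltr0n.
rewrite ler_pdivrMr //.
apply: (@le_trans _ _ (log2 ((1000 * s0)%N%:R * (a + b)%:R))).
  apply: ler_log2.
    apply: mulr_gt0; last exact: lt_le_trans ls1.
    by apply: mulr_gt0 nR; rewrite ltr0n.
  rewrite natrM mulrAC ler_pM2r // ler_pM2l ?ltr0n //.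
  by apply: le_trans (log2_le_nat _ _) _; rewrite ?ler_nat // ltnW.
have -> : log2 ((1000 * s0)%N%:R * (a + b)%:R) =
    log2 ((1000 * s0)%N%:R) + log2 ((a + b)%:R) :> R.
  by rewrite /log2 lnM ?posrE // mulrDl.
apply: (@le_trans _ _ (((1000 * s0)%N%:R + 1) * log2 (a + b)%:R)).
  rewrite mulrDl mul1r lerD2r; apply: le_trans (log2_le_nat _ s00) _.
  by rewrite ler_peMr // ltW.
by rewrite [leRHS]mulrC -ler_pdivrMr // mulrAC; exact: h.
Qed.

End Main.

Theorem theorem13 (R : realType) :
  exists (P : seq instr) (p : {poly R}),
    (* constant delta and bounded alphabets *)
    (forall (delta : R) (s0 : nat) (eps : R), 0 < delta -> 0 < eps ->
     exists n0 : nat,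
     forall (a b s : nat) (L : label_cover 'I_a 'I_b 'I_s),
       biregular L -> edges L != set0 -> (1 < s)%N -> (s <= s0)%N ->
       (n0 <= a + b)%N ->
       [/\ forall w, size_property L p delta (reduction L P p delta w),
           forall w : (time_bound L p delta).-tuple bool,
             completeness_property R L (reduction L P p delta w)
         & 1 - eps <=
             Pr (fun w : (time_bound L p delta).-tuple bool =>
                   soundness_property L delta (reduction L P p delta w))])
    /\
    (* delta and the alphabet may vary with n *)
    (forall eps : R, 0 < eps ->
     exists n0 : nat,
     forall (a b s : nat) (L : label_cover 'I_a 'I_b 'I_s) (delta : R),
       biregular L -> edges L != set0 -> (1 < s)%N ->
       (n0 <= a + b)%N ->
       0 < delta ->
       log2 (1000 * (a + b)%:R * log2 s%:R) / r_of R (a + b) <= delta ->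
       1 - eps <=
         Pr (fun w : (time_bound L p delta).-tuple bool =>
               [&& size_property L p delta (reduction L P p delta w),
                   completeness_property R L (reduction L P p delta w)
                 & soundness_property L delta (reduction L P p delta w)])).
Proof.
exists reduction_program, (exponent_poly R); split.
  move=> delta s0 eps d0 e0; have [k1 h1] := soundness_likely e0.
  have [k2 h2] := admissible_delta s0 d0.
  exists (maxn k1 k2) => a b s L bireg E0 s1 ss0; rewrite geq_max => /andP[n1 n2].
  have [_ _ _ nn] := sizes_le bireg E0.
  split=> [w|w|]; try by have [] := reduction_correct bireg E0 s1 d0 w.
  by apply: h1 => //; exact: h2.
move=> eps e0; have [k1 h1] := soundness_likely e0.
exists k1 => a b s L delta bireg E0 s1 n1 d0 hd.
apply: le_trans (h1 _ _ _ _ _ bireg E0 s1 n1 d0 hd) _.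
(* Size and completeness hold for every coin sequence, so the conjunction is the same event as
   soundness. *)
rewrite le_eqVlt; apply/orP; left; apply/eqP; rewrite /Pr; congr (_%:R / _).
apply: eq_card => w; rewrite !inE.
by have [-> -> _] := reduction_correct bireg E0 s1 d0 w.
Qed.
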